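(* Let $\Gamma$ be a shellable $(d-1)$-dimensional shifted simplicial complex on the vertex set $[n]$, and let $\Sigma_\Gamma$ be its set of minimal non-faces. For $1\le j\le n-d$ let $$\Sigma_j=\{\sigma\in\Sigma_\Gamma : \sigma=A\cup\{d-|A|+j\}\text{ for some } A\subseteq [n]\setminus[d-|A|+j]\},$$ let $k$ be a field, $S=k[x_1,\dots,x_n]$, and let $$M_j=\Big\langle \prod_{i\in\sigma}x_i^{\,n-d-j+1} : \sigma\in\Sigma_j\Big\rangle\subset S,\qquad M=M_1+\cdots+M_{n-d}.$$ Then $M$ is a deformation of the Stanley-Reisner ideal $I_\Gamma$ that is generic and Cohen-Macaulay.
   Context: $[m]=\{1,\dots,m\}$. A simplicial complex $\Gamma$ on $[n]$ is a non-empty collection of subsets of $[n]$ (faces), closed under taking subsets, with $\{i\}\in\Gamma$ for all $i\in[n]$; $\dim(\sigma)=|\sigma|-1$ and $\dim(\Gamma)$ is the maximum dimension of a face. A minimal non-face is a set $\sigma\subseteq[n]$ with $\sigma\notin\Gamma$ and $\sigma\setminus\{i\}\in\Gamma$ for each $i\in\sigma$. $\Gamma$ is shifted if for all $\sigma\in\Gamma$, $j\in\sigma$ and $i\in[n]$ with $i<j$ one has $(\sigma\setminus\{j\})\cup\{i\}\in\Gamma$. Shellable is meant in the pure sense: all facets (maximal faces) have the same dimension $d-1$, and they can be ordered $F_1,\dots,F_t$ so that for $1<i\le t$ the subcomplex of faces of $F_i$ contained in some $F_l$, $l<i$, is pure of dimension $d-2$. The Stanley-Reisner ideal is $I_\Gamma=\langle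 \prod_{i\in\sigma}x_i : \sigma\subseteq[n],\ \sigma\notin\Gamma\rangle$. A deformation of a square-free monomial ideal $I$ with minimal generators $m_1,\dots,m_t$ is a monomial ideal $\langle m_1^*,\dots,m_t^*\rangle$ such that for each $i$, if $m_i=x_{i_1}\cdots x_{i_s}$, then $m_i^*=x_{i_1}^{j_1}\cdots x_{i_s}^{j_s}$ for some positive integers $j_1,\dots,j_s$. $x^{a}$ strictly divides $x^{b}$ if $a_i<b_i$ for every $i$ with $a_i>0$. A monomial ideal is generic if for any two distinct minimal generators $m_i,m_j$ having the same positive degree in some variable, there is a third minimal generator that strictly divides $\mathrm{lcm}(m_i,m_j)$. An ideal $M$ is Cohen-Macaulay if $S/M$ is a Cohen-Macaulay ring. *)

(* Defs.v *)
From mathcomp Require Import all_boot all_order all_algebra.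
From mathcomp Require Import ring_quotient.
From mathcomp.multinomials Require Import mpoly.

Set Implicit Arguments.
Unset Strict Implicit.
Unset Printing Implicit Defensive.

Import GRing.Theory.
Local Open Scope ring_scope.

(* The vertex set [n] = {1, ..., n} is represented by 'I_n; the ordinal [i]
   stands for the vertex i + 1. *)
Section Complexes.
Variable n : nat.
Implicit Types (G : {set {set 'I_n}}) (s F : {set 'I_n}).

Definition label (i : 'I_n) : nat := i.+1.

(* [m] = {1, ..., m}, as a subset of [n] *)
Definition initial (m : nat) : {set 'I_n} := [set i | (label i <= m)%N].

Definition is_complex G : Prop :=
  [/\ G != set0,
      forall s t : {set 'I_n}, s \in G -> t \subset s -> t \in G
    & forall i : 'I_n, [set i] \in G].

(* Dimensions are integers, so that the empty face has dimension -1. *)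
Definition face_dim s : int := #|s|%:Z - 1.

Definition complex_dim G : int := (\max_(s in G) #|s|)%N%:Z - 1.

Definition facets G : {set {set 'I_n}} :=
  [set F | maxset [pred s | s \in G] F].

Definition pure_of_dim G (e : int) : Prop :=
  forall F, F \in facets G -> face_dim F = e.

(* The facets are numbered from 0, so 1 < i <= t becomes 0 < i < t. *)
Definition shellable G : Prop :=
  pure_of_dim G (complex_dim G) /\
  exists Fs : seq {set 'I_n},
    [/\ uniq Fs,
        Fs =i facets G
      & forall i, (0 < i < size Fs)%N ->
          pure_of_dim
            [set s : {set 'I_n} | (s \subset nth set0 Fs i)
                     && [exists l : 'I_i, s \subset nth set0 Fs l]]
            (complex_dim G - 1)].

Definition shifted G : Prop :=
  forall s (i j : 'I_n), s \in G -> j \in s -> (label i < label j)%N ->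
    (s :\ j) :|: [set i] \in G.

Definition min_nonfaces G : {set {set 'I_n}} :=
  [set s : {set 'I_n} | (s \notin G) && [forall i in s, s :\ i \in G]].

(* [v] is the vertex d - |A| + j. *)
Definition Sigma_j (d : nat) G (j : nat) s : Prop :=
  s \in min_nonfaces G /\
  exists (A : {set 'I_n}) (v : 'I_n),
    [/\ (label v)%:Z = d%:Z - #|A|%:Z + j%:Z,
        A \subset ~: initial (label v)
      & s = A :|: [set v]].

End Complexes.

(* Ideals are Prop-valued predicates: membership in a generated ideal is not
   decidable in general, whereas [idealr] is restricted to boolean ones. *)
Section Ideals.
Variable R : comNzRingType.
Implicit Types (I J P : R -> Prop) (s : seq R).

Definition is_ideal I : Prop :=
  [/\ I 0,
      forall x y, I x -> I y -> I (x + y)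
    & forall a x, I x -> I (a * x)].

Definition ideal_gen (X : R -> Prop) : R -> Prop := fun x =>
  exists cs : seq (R * R),
    (forall c, c \in cs -> X c.2) /\ x = \sum_(c <- cs) c.1 * c.2.

(* M_1 + ... + M_N *)
Definition ideal_sum (N : nat) (M : nat -> R -> Prop) : R -> Prop := fun x =>
  exists q : nat -> R,
    (forall j, (1 <= j <= N)%N -> M j (q j)) /\ x = \sum_(1 <= j < N.+1) q j.

Definition is_prime P : Prop :=
  [/\ is_ideal P,
      ~ P 1
    & forall x y, P (x * y) -> P x \/ P y].

Definition is_maximal P : Prop :=
  [/\ is_ideal P,
      ~ P 1
    & forall J, is_ideal J -> (forall x, P x -> J x) ->
        J 1 \/ (forall x, J x -> P x)].

Definition noetherian : Prop :=
  forall I, is_ideal I ->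
    exists s, forall x, I x <-> ideal_gen (fun y => y \in s) x.

Definition prime_chain_below P (h : nat) : Prop :=
  exists Q : nat -> R -> Prop,
    [/\ forall i, (i <= h)%N -> is_prime (Q i),
        forall i, (i < h)%N ->
          (forall x, Q i x -> Q i.+1 x) /\ (exists x, Q i.+1 x /\ ~ Q i x)
      & forall x, Q h x <-> P x].

Definition is_height P (h : nat) : Prop :=
  prime_chain_below P h /\
  forall h', prime_chain_below P h' -> (h' <= h)%N.

Definition regular_seq s : Prop :=
  (forall i, (i < size s)%N -> forall x,
     ideal_gen (fun y => y \in take i s) (s`_i * x) ->
     ideal_gen (fun y => y \in take i s) x) /\
  ~ ideal_gen (fun y => y \in s) 1.

Definition is_depth P (r : nat) : Prop :=
  (exists s, [/\ regular_seq s, forall x, x \in s -> P x & size s = r]) /\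
  forall s, regular_seq s -> (forall x, x \in s -> P x) -> (size s <= r)%N.

(* Eisenbud, "Commutative Algebra", Section 18.2: a Noetherian ring in which
   every maximal ideal P satisfies depth P = codim P. *)
Definition cohen_macaulay_ring : Prop :=
  noetherian /\
  forall P, is_maximal P -> exists h, is_height P h /\ is_depth P h.

End Ideals.

(* The quotient [{ideal_quot J}] needs a proper ideal with boolean membership;
   [J] is [I] itself in that form. *)
Definition cohen_macaulay (R : comNzRingType) (I : R -> Prop) : Prop :=
  exists J : idealr R,
    (forall p : R, (p \in (J : pred R)) <-> I p) /\
    cohen_macaulay_ring {ideal_quot J}.

Section MonomialIdeals.
Variables (k : fieldType) (n : nat).
Local Notation S := {mpoly k[n]}.
Implicit Types (I D : S -> Prop) (gens : seq 'X_{1..n}).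

Definition monomial_ideal gens : S -> Prop :=
  ideal_gen (fun p : S => exists2 m, m \in gens & p = 'X_[m]).

Definition min_generators I gens : Prop :=
  [/\ uniq gens,
      forall p, I p <-> monomial_ideal gens p
    & forall m, m \in gens ->
        ~ (forall p, I p <-> monomial_ideal (rem m gens) p)].

Definition squarefree_mnm (m : 'X_{1..n}) : Prop := forall i, (m i <= 1)%N.

Definition is_deformation I D : Prop :=
  exists gens : seq 'X_{1..n},
    [/\ min_generators I gens,
        forall m, m \in gens -> squarefree_mnm m
      & exists star : 'X_{1..n} -> 'X_{1..n},
          (forall m, m \in gens -> forall i, (0 < star m i)%N = (0 < m i)%N) /\
          (forall p, D p <-> monomial_ideal (map star gens) p)].

Definition strictly_divides (a b : 'X_{1..n}) : Prop :=
  forall i, (0 < a i)%N -> (a i < b i)%N.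

Definition generic I : Prop :=
  exists gens : seq 'X_{1..n},
    min_generators I gens /\
    forall m1 m2, m1 \in gens -> m2 \in gens -> m1 != m2 ->
      (exists i, m1 i = m2 i /\ (0 < m1 i)%N) ->
      exists m, [/\ m \in gens, m != m1, m != m2
                  & strictly_divides m (mlcm m1 m2)].

Definition stanley_reisner (G : {set {set 'I_n}}) : S -> Prop :=
  ideal_gen (fun p : S =>
    exists s : {set 'I_n}, s \notin G /\ p = \prod_(i in s) 'X_i).

Definition M_j (d : nat) (G : {set {set 'I_n}}) (j : nat) : S -> Prop :=
  ideal_gen (fun p : S =>
    exists s : {set 'I_n},
      Sigma_j d G j s /\ p = \prod_(i in s) 'X_i ^+ (n - d - j + 1)).

Definition M_ideal (d : nat) (G : {set {set 'I_n}}) : S -> Prop :=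
  ideal_sum (n - d) (M_j d G).

End MonomialIdeals.

Arguments stanley_reisner k {n} G.
Arguments M_j k {n} d G j.
Arguments M_ideal k {n} d G.

(* Main.v *)
From HB Require Import structures.
Require Import Defs.
From mathcomp Require Import all_boot all_order all_algebra.
From mathcomp Require Import generic_quotient ring_quotient ring zify.
From mathcomp.multinomials Require Import mpoly.
From mathcomp Require boolp classical_sets.

(* With [gap s] one plus the number of vertices above [min s] missing from [s],
   M is generated by the powers [x_s ^ (gap s)] of the minimal non-faces [s].
   If [B] is not a face, then the minimal non-face in [B] with the largest least
   vertex is a final segment of [B], and it is the only one in [B] with the
   smallest value of [gap]. Applied to a union of two minimal non-faces, this is
   genericity.

   Applied to sets [B] of [n - t] vertices, t = 0, ..., n - d, it refines step by
   step the trivial filtration of S/M into one whose quotients are polynomial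
   rings k[x_F] with [#|F| = d]. A sequence that is weakly regular on all these
   rings is weakly regular on S/M. If P is a maximal ideal of S/M, then Zariski's
   lemma yields monic f_i with f_i(x_i) in P; the elementary symmetric
   polynomials e_d, ..., e_1 in the n elements x_i f_i(x_i) lie in P and form
   such a sequence. As a chain of primes lies below any regular sequence, it
   remains to bound the length of chains of primes by d: otherwise there would
   be too many independent monomials in d + 1 elements modulo a prime that
   contains all variables outside of a face. *)

Set Implicit Arguments.
Unset Strict Implicit.
Unset Printing Implicit Defensive.

Import GRing.Theory.
Local Open Scope ring_scope.
Local Open Scope quotient_scope.

(** * Ideals, primes and weakly regular sequences *)

Section IdealTheory.
Variable R : comNzRingType.
Implicit Types (I J P T : R -> Prop) (s : seq R).

Lemma idealD I x y : is_ideal I -> I x -> I y -> I (x + y).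
Proof. by case=> _ + _; apply. Qed.

Lemma idealM I a x : is_ideal I -> I x -> I (a * x).
Proof. by case=> _ _; apply. Qed.

Lemma idealMx I a x : is_ideal I -> I x -> I (x * a).
Proof. by rewrite mulrC; apply: idealM. Qed.

Lemma ideal0 I : is_ideal I -> I 0.
Proof. by case. Qed.

Lemma idealN I x : is_ideal I -> I x -> I (- x).
Proof. by move=> idI Ix; rewrite -mulN1r; apply: idealM. Qed.

Lemma idealB I x y : is_ideal I -> I x -> I y -> I (x - y).
Proof. by move=> idI Ix Iy; apply: idealD => //; apply: idealN. Qed.

Lemma ideal_sumr I (K : Type) (r : seq K) (Q : pred K) (F : K -> R) :
  is_ideal I -> (forall i, Q i -> I (F i)) -> I (\sum_(i <- r | Q i) F i).
Proof.
move=> idI IF; apply: (big_ind I) => //; first exact: ideal0.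
by move=> x y; apply: idealD.
Qed.

Lemma idealBD I x y : is_ideal I -> I (x - y) -> I y -> I x.
Proof. by move=> idI Ixy Iy; rewrite -(subrK y x); apply: idealD. Qed.

Lemma ideal_gen_ideal (X : R -> Prop) : is_ideal (ideal_gen X).
Proof.
split.
- by exists [::]; rewrite big_nil.
- move=> x y [cs [Xcs ->]] [ds [Xds ->]]; exists (cs ++ ds); split.
    by move=> c; rewrite mem_cat => /orP[/Xcs|/Xds].
  by rewrite big_cat.
- move=> a x [cs [Xcs ->]]; exists [seq (a * c.1, c.2) | c <- cs]; split.
    by move=> _ /mapP[c /Xcs Xc ->].
  by rewrite big_map mulr_sumr; apply: eq_bigr => c _; rewrite mulrA.
Qed.

Lemma ideal_gen_sub (X I : R -> Prop) : is_ideal I -> (forall x, X x -> I x) ->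
  forall x, ideal_gen X x -> I x.
Proof.
move=> idI XI x [cs [Xcs ->]]; rewrite big_seq; apply: ideal_sumr => // c /Xcs.
by move=> /XI; apply: idealM.
Qed.

Lemma sub_ideal_gen (X : R -> Prop) x : X x -> ideal_gen X x.
Proof.
move=> Xx; exists [:: (1, x)]; split; last by rewrite big_seq1 mul1r.
by move=> c; rewrite inE => /eqP->.
Qed.

(** The ideal J + (g), with one witness instead of a list of coefficients; [foldl] along a sequence
    s turns it into J + (s). *)
Definition addI J g : R -> Prop := fun x => exists a, J (x - g * a).

Lemma addI_ideal J g : is_ideal J -> is_ideal (addI J g).
Proof.
move=> idJ; split.
- by exists 0; rewrite mulr0 subr0; apply: ideal0.
- move=> x y [a Ja] [b Jb]; exists (a + b).
  have -> : x + y - g * (a + b) = (x - g * a) + (y - g * b) by ring.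
  exact: idealD.
- move=> c x [a Ja]; exists (c * a).
  have -> : c * x - g * (c * a) = c * (x - g * a) by ring.
  exact: idealM.
Qed.

Lemma addI_sub J g x : J x -> addI J g x.
Proof. by move=> Jx; exists 0; rewrite mulr0 subr0. Qed.

Lemma addI_gen J g a : is_ideal J -> addI J g (g * a).
Proof. by move=> idJ; exists a; rewrite subrr; apply: ideal0. Qed.

Lemma addI_min J I g x : is_ideal I -> (forall y, J y -> I y) -> I g ->
  addI J g x -> I x.
Proof.
move=> idI JI Ig [a /JI]; move/(idealBD idI); apply.
exact: idealMx.
Qed.

Definition colonI J u : R -> Prop := fun x => J (u * x).

(* [wreg J s] says that [s] is a weakly regular sequence on [R/J]: no
   properness is required, so that it holds vacuously on the zero module. *)
Fixpoint wreg J s : Prop :=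
  if s is g :: s' then (forall x, J (g * x) -> J x) /\ wreg (addI J g) s'
  else True.

Lemma eq_wreg J J' s : (forall x, J x <-> J' x) -> wreg J s -> wreg J' s.
Proof.
by move=> eqJ; suff -> : J = J' by []; apply/boolp.predeqP.
Qed.

Lemma wreg1 J s : is_ideal J -> J 1 -> wreg J s.
Proof.
elim: s J => //= g s IHs J idJ J1; split; last first.
  by apply: IHs; [apply: addI_ideal | apply: addI_sub].
by move=> x _; rewrite -[x]mulr1; apply: idealM.
Qed.

(* The exact sequence 0 -> R/(J:u) -> R/J -> R/(J+(u)) -> 0. *)
Lemma wreg_filter J u s : is_ideal J ->
  wreg (colonI J u) s -> wreg (addI J u) s -> wreg J s.
Proof.
elim: s J => //= g s IHs J idJ [nzc wc] [nza wa]; split.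
  move=> x Jgx; have [] := nza x; first exact: addI_sub.
  move=> a Ja; apply: (idealBD idJ Ja); apply: nzc; rewrite /colonI.
  have -> : u * (g * a) = g * x - g * (x - u * a) by ring.
  by apply: idealB => //; apply: idealM.
apply: IHs; first exact: addI_ideal.
(* Taking the colon by u commutes with adding g, because g is a nonzerodivisor modulo J + (u). *)
- apply: eq_wreg wc => x; rewrite /addI /colonI; split.
    case=> a Ja; exists (u * a).
    by have -> : u * x - g * (u * a) = u * (x - g * a) by ring.
  case=> b Jb.
  have [] : addI J u b.
    apply: nza; exists x.
    have -> : g * b - u * x = - (u * x - g * b) by ring.
    exact: idealN.
  move=> c Jc; exists c.
  have -> : u * (x - g * c) = (u * x - g * b) + g * (b - u * c) by ring.
  by apply: idealD => //; apply: idealM.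
- apply: eq_wreg wa => x; split=> -[a [b Jab]]; exists b, a.
    by have -> : x - u * b - g * a = x - g * a - u * b by ring.
  by have -> : x - g * b - u * a = x - u * a - g * b by ring.
Qed.

Lemma wreg_rcons J s g : wreg J (rcons s g) <->
  wreg J s /\ forall x, foldl addI J s (g * x) -> foldl addI J s x.
Proof.
elim: s J => [|h s IHs] J /=; first by split; case.
by rewrite IHs; split=> [[? []]|[[]]].
Qed.

Lemma foldl_addI_ideal J s : is_ideal J -> is_ideal (foldl addI J s).
Proof. by elim: s J => //= g s IHs J idJ; apply/IHs/addI_ideal. Qed.

Lemma foldl_addI_sub J s x : J x -> foldl addI J s x.
Proof. by elim: s J => //= g s IHs J Jx; apply/IHs/addI_sub. Qed.

Lemma foldl_addI_mem J s x : is_ideal J -> x \in s -> foldl addI J s x.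
Proof.
elim: s J => //= g s IHs J idJ; rewrite inE => /orP[/eqP->|xs]; last first.
  by apply: IHs => //; apply: addI_ideal.
by apply: foldl_addI_sub; rewrite -[X in addI _ _ X]mulr1; apply: addI_gen.
Qed.

Lemma foldl_addI_min J s I : is_ideal I -> (forall x, J x -> I x) ->
  (forall x, x \in s -> I x) -> forall x, foldl addI J s x -> I x.
Proof.
elim: s J => //= g s IHs J idI JI sI; apply: IHs => // [x|x xs].
  by apply: addI_min => //; apply: sI; rewrite mem_head.
by apply: sI; rewrite inE xs orbT.
Qed.

End IdealTheory.

(** * Primes below weakly regular sequences *)

Section Primes.
Variable R : comNzRingType.
Implicit Types (I J P T : R -> Prop) (s : seq R).

(** By Zorn's lemma, some ideal Q is maximal among those that contain J and avoid T. If x and y are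
    outside Q, then Q + (x) and Q + (y) both meet T; if x * y were in Q, the product of the two
    elements found would lie in both T and Q. *)
Lemma prime_avoid J T : is_ideal J -> T 1 ->
  (forall x y, T x -> T y -> T (x * y)) -> (forall x, T x -> ~ J x) ->
  exists Q : R -> Prop, [/\ is_prime Q, forall x, J x -> Q x & forall x, T x -> ~ Q x].
Proof.
move=> idJ T1 TM TJ.
pose ok I := [/\ is_ideal I, forall x, J x -> I x & forall x, T x -> ~ I x].
pose ok0 I := (forall x, ~ I x) \/ ok I.
have [F Fok Ftot|Q [okQ Qmax]] := @classical_sets.Zorn_bigcup R ok0.
  have [[I0 FI0 okI0]|noF] := boolp.pselect (exists2 I, F I & ok I); last first.
    left=> x [I FI Ix]; have [/(_ x)//|okI] := Fok _ FI.
    by apply: noF; exists I.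
  right; split.
  - split.
    + by exists I0 => //; case: okI0 => /ideal0.
    + move=> x y [I FI Ix] [I' FI' Iy].
      have [II'|I'I] := Ftot _ _ FI FI'.
        exists I' => //; case: (Fok _ FI') => [/(_ _ Iy)//|[idI' _ _]].
        by apply: idealD => //; apply: II'.
      exists I => //; case: (Fok _ FI) => [/(_ _ Ix)//|[idI _ _]].
      by apply: idealD => //; apply: I'I.
    + move=> a x [I FI Ix]; exists I => //.
      case: (Fok _ FI) => [/(_ _ Ix)//|[idI _ _]]; exact: idealM.
  - by move=> x Jx; exists I0 => //; case: okI0 => _ JI0 _; apply: JI0.
  - move=> x Tx [I FI Ix]; case: (Fok _ FI) => [/(_ x)/(_ Ix)|[_ _ TI]] //.
    exact: (TI x).
have{okQ} [noQ|[idQ JQ TQ]] := okQ.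
  exfalso; apply: (Qmax J); last by right.
  split; first by move=> x /noQ.
  by move/(_ _ (ideal0 idJ)) => /noQ.
exists Q; split=> //; split=> //; first exact: TQ.
move=> x y Qxy; apply: boolp.contrapT => /boolp.not_orP[nQx nQy].
have key z : ~ Q z -> exists t, T t /\ addI Q z t.
  move=> nQz; apply: boolp.contrapT => noT.
  apply: (Qmax (addI Q z)).
    split; first by move=> w Qw; apply: addI_sub.
    move=> /(_ z) sub; apply: nQz; apply: sub.
    by rewrite -[X in addI _ _ X]mulr1; apply: addI_gen.
  right; split; first exact: addI_ideal.
    by move=> w /JQ; apply: addI_sub.
  by move=> t Tt Qt; apply: noT; exists t.
have [t [Tt [a Qa]]] := key x nQx; have [t' [Tt' [b Qb]]] := key y nQy.
apply: (TQ _ (TM _ _ Tt Tt')).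
have -> : t * t' = t' * (t - x * a) + (x * a) * (t' - y * b) + (x * y) * (a * b).
  ring.
apply: idealD => //; last exact: idealMx.
by apply: idealD => //; apply: idealM.
Qed.

(** The elements x ^+ i * s with s outside P form a multiplicative set that avoids J, since x is a
    nonzerodivisor modulo J. A prime that avoids this set lies in P and does not contain x. *)
Lemma prime_below J P x : is_ideal J -> is_prime P -> (forall y, J y -> P y) ->
  (forall y, J (x * y) -> J y) ->
  exists Q : R -> Prop,
    [/\ is_prime Q, forall y, J y -> Q y, forall y, Q y -> P y & ~ Q x].
Proof.
move=> idJ [idP P1 PM] JP nzx.
pose T z := exists i (s : R), ~ P s /\ z = x ^+ i * s.
have [] := @prime_avoid J T idJ.
- by exists 0%N, 1; rewrite mulr1.
- move=> _ _ [i [s [Ps ->]]] [j [t [Pt ->]]]; exists (i + j)%N, (s * t); split.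
    by case/PM.
  by rewrite exprD; ring.
- move=> _ [i [s [Ps ->]]] Jxs; apply: Ps; apply: JP.
  elim: i Jxs => [|i IHi]; first by rewrite mul1r.
  by rewrite exprS -mulrA => /nzx.
move=> Q [prQ JQ TQ]; exists Q; split=> //.
  move=> y Qy; apply: boolp.contrapT => nPy; apply: (TQ y) => //.
  by exists 0%N, y; rewrite mul1r.
by apply: TQ; exists 1%N, 1; rewrite mulr1.
Qed.

(** Induction from the end of the sequence: its last element g lies in P and is a nonzerodivisor
    modulo the ideal of the preceding elements, so a prime over that ideal lies in P and misses
    g. *)
Lemma wreg_chain J P s : is_ideal J -> is_prime P -> (forall x, J x -> P x) ->
  wreg J s -> (forall x, x \in s -> P x) -> prime_chain_below P (size s).
Proof.
move=> idJ; elim/last_ind: s P => [|s g IHs] P prP JP.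
  by move=> _ _; exists (fun=> P); split.
move=> /wreg_rcons[wr nzg] sP.
have idP : is_ideal P by case: prP.
have [|Q [prQ JQ QP nQg]] := prime_below (foldl_addI_ideal s idJ) prP _ nzg.
  apply: foldl_addI_min => // x xs; apply: sP.
  by rewrite mem_rcons inE xs orbT.
have [|//||C [C1 C2 C3]] := IHs Q prQ.
- by move=> x Jx; apply: JQ; apply: foldl_addI_sub.
- by move=> x xs; apply: JQ; apply: foldl_addI_mem.
exists (fun i => if (i <= size s)%N then C i else P); rewrite size_rcons.
split=> [i|i|x]; last by rewrite ltnn.
  by rewrite leq_eqVlt => /predU1P[->|]; rewrite ?ltnn // ltnS => les; rewrite les; apply: C1.
rewrite ltnS => les; rewrite les; case: ltnP => [lts|ges]; first exact: C2.
have <- : size s = i by apply/eqP; rewrite eqn_leq ges.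
split; first by move=> x /C3/QP.
by exists g; split; [apply: sP; rewrite mem_rcons mem_head | move/C3].
Qed.

Lemma zero_ideal : is_ideal (fun y : R => y = 0).
Proof. by split=> // [x y -> ->|a _ ->]; rewrite ?addr0 ?mulr0. Qed.

Lemma ideal_gen_foldl s x :
  ideal_gen (fun y => y \in s) x <-> foldl (@addI R) (fun y => y = 0) s x.
Proof.
have id0 := zero_ideal; split.
  apply: ideal_gen_sub; first exact: foldl_addI_ideal.
  by move=> y; apply: foldl_addI_mem.
have idS := ideal_gen_ideal (fun y : R => y \in s).
apply: foldl_addI_min => // [y ->|y]; first exact: ideal0.
by move=> ys; apply: sub_ideal_gen.
Qed.

Lemma wregP J s : wreg J s <-> forall i, (i < size s)%N ->
  forall x, foldl (@addI R) J (take i s) (s`_i * x) -> foldl (@addI R) J (take i s) x.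
Proof.
elim: s J => [|g s IHs] J /=; first by split.
split=> [[nz /IHs wr] [|i] //=|H]; first exact: wr.
by split; [apply: (H 0%N) | apply/IHs => i; apply: (H i.+1)].
Qed.

Lemma regular_seqP s : regular_seq s <->
  wreg (fun y => y = 0) s /\ ~ ideal_gen (fun y => y \in s) 1.
Proof.
rewrite /regular_seq wregP; split=> -[H H1]; split=> // i lti x.
  by move=> /ideal_gen_foldl/H => /(_ lti)/ideal_gen_foldl.
by move=> /ideal_gen_foldl/H => /(_ lti)/ideal_gen_foldl.
Qed.

Lemma maximal_prime P : is_maximal P -> is_prime P.
Proof.
move=> [idP P1 maxP]; split=> // x y Pxy.
apply: boolp.contrapT => /boolp.not_orP[nPx nPy].
have [|||] := maxP (addI P x); first exact: addI_ideal.
- by move=> z; apply: addI_sub.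
- case=> a Pa; apply: nPy.
  have -> : y = y * (1 - x * a) + (x * y) * a by ring.
  by apply: idealD => //; [apply: idealM | apply: idealMx].
- move=> sub; apply: nPx; apply: sub; rewrite -[X in addI _ _ X]mulr1.
  exact: addI_gen.
Qed.

(** The given sequence in P yields a chain of length d by [wreg_chain], so the height is d. A
    regular sequence in P also yields a chain of its own length, so the bound on chains bounds the
    depth as well. *)
Lemma cohen_macaulay_ring_of (d : nat) :
  noetherian R ->
  (forall P h, prime_chain_below P h -> (h <= d)%N) ->
  (forall P, is_maximal P -> exists s,
     [/\ wreg (fun y => y = 0) s, forall x, x \in s -> P x & size s = d]) ->
  cohen_macaulay_ring R.
Proof.
move=> noR dimR regR; split=> // P maxP; exists d.
have prP := maximal_prime maxP; have [idP P1 PM] := prP.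
have P0 x : x = 0 -> P x by move->; apply: ideal0.
have [s [wr sP sz]] := regR P maxP.
split; split.
- by rewrite -sz; apply: wreg_chain wr sP => //; apply: zero_ideal.
- exact: dimR.
- exists s; split=> //; apply/regular_seqP; split=> //.
  by move/(ideal_gen_sub idP sP).
- move=> t /regular_seqP[wrt _] tP; apply: (dimR P).
  by apply: wreg_chain wrt tP => //; apply: zero_ideal.
Qed.

End Primes.

(** * Hilbert's basis theorem and Zariski's lemma *)

Section Adjunction.
Variable K : comNzRingType.

Definition adjoin (R : comNzRingType) (phi : {rmorphism R -> K}) (a : K) :
  {rmorphism {poly R} -> K} :=
  horner_morph (fun x => mulrC a (phi x) : GRing.comm a (phi x)).

Arguments adjoin : simpl never.

Lemma adjoinE R phi a p : @adjoin R phi a p = (map_poly phi p).[a].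
Proof. by []. Qed.

Lemma adjoinC R phi a c : @adjoin R phi a c%:P = phi c.
Proof. by rewrite adjoinE map_polyC hornerC. Qed.

Lemma adjoinX R phi a : @adjoin R phi a 'X = a.
Proof. by rewrite adjoinE map_polyX hornerX. Qed.

(* [z] lies in the subring generated by the image of [phi] and by [s]. *)
Fixpoint generated (s : seq K) (R : comNzRingType) (phi : {rmorphism R -> K})
    (z : K) : Prop :=
  if s is a :: s' then generated s' (adjoin phi a) z else exists r, z = phi r.

Lemma generatedD s (R : comNzRingType) (phi : {rmorphism R -> K}) y z :
  generated s phi y -> generated s phi z -> generated s phi (y + z).
Proof.
elim: s R phi => [|a s IHs] R phi /=; last exact: IHs.
by case=> q -> [r ->]; exists (q + r); rewrite rmorphD.
Qed.

Lemma generatedM s (R : comNzRingType) (phi : {rmorphism R -> K}) y z :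
  generated s phi y -> generated s phi z -> generated s phi (y * z).
Proof.
elim: s R phi => [|a s IHs] R phi /=; last exact: IHs.
by case=> q -> [r ->]; exists (q * r); rewrite rmorphM.
Qed.

Lemma generated_base s (R : comNzRingType) (phi : {rmorphism R -> K}) r :
  generated s phi (phi r).
Proof.
elim: s R phi r => [|a s IHs] R phi r /=; first by exists r.
by rewrite -(adjoinC phi a).
Qed.

Lemma generated_mem s (R : comNzRingType) (phi : {rmorphism R -> K}) a :
  a \in s -> generated s phi a.
Proof.
elim: s R phi => //= b s IHs R phi; rewrite inE => /orP[/eqP->|]; last exact: IHs.
by rewrite -{2}(adjoinX phi b); apply: generated_base.
Qed.

End Adjunction.

Lemma noetherian_field (k : fieldType) : noetherian k.
Proof.
move=> I idI; have [[x [Ix nx]]|noI] := boolp.pselect (exists x, I x /\ x != 0).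
  exists [:: 1] => y; split=> _.
    by rewrite -[y]mulr1; apply/(idealM _ (ideal_gen_ideal _))/sub_ideal_gen/mem_head.
  by rewrite -[y](divfK nx); apply: idealM.
exists [::] => y; split=> [Iy|[[|c cs] [csP ->]]]; last 2 first.
- by rewrite big_nil; apply: ideal0.
- by have := csP c (mem_head _ _).
suff -> : y = 0 by exact: (ideal0 (ideal_gen_ideal _)).
by apply: boolp.contrapT => /eqP ny; apply: noI; exists y.
Qed.

Lemma noetherian_surj (R K : comNzRingType) (phi : {rmorphism R -> K}) :
  (forall z, exists r, z = phi r) -> noetherian R -> noetherian K.
Proof.
move=> surj noR I idI.
have [|s sP] := noR (fun r => I (phi r)).
  split=> [|x y Ix Iy|a x Ix].
  - by rewrite rmorph0; apply: ideal0.
  - by rewrite rmorphD; apply: idealD.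
  - by rewrite rmorphM; apply: idealM.
exists (map phi s) => z; split; last first.
  apply: ideal_gen_sub => // _ /mapP[r rs ->]; apply/sP.
  by apply: sub_ideal_gen.
have [r ->] := surj z => /sP[cs [csP ->]].
rewrite rmorph_sum big_seq; have idS := ideal_gen_ideal (fun y => y \in map phi s).
apply: ideal_sumr => // c /csP cs2; rewrite rmorphM; apply: idealM => //.
by apply: sub_ideal_gen; apply: map_f.
Qed.

Lemma size_poly_leq_coef0 (R : nzRingType) (p : {poly R}) d :
  (size p <= d.+1)%N -> p`_d = 0 -> (size p <= d)%N.
Proof.
move=> szp pd; apply/leq_sizeP => j; rewrite leq_eqVlt => /predU1P[<-//|ltdj].
by apply: (leq_sizeP _ _ szp).
Qed.

(** [L d] is the ideal of leading coefficients in degree d of elements of I, together with 0. These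
    ideals increase and their union is reached at some D; lifts of generators of [L d] for d at most
    D generate I, by cancelling leading terms. *)
Lemma hilbert_basis (R : comNzRingType) : noetherian R -> noetherian {poly R}.
Proof.
move=> noR I idI.
pose L d a := exists p : {poly R}, [/\ I p, (size p <= d.+1)%N & p`_d = a].
have idL d : is_ideal (L d).
  split; first by exists 0; rewrite size_poly0 coef0; split=> //; apply: ideal0.
    move=> _ _ [p [Ip szp <-]] [q [Iq szq <-]]; exists (p + q).
    rewrite coefD; split=> //; first exact: idealD.
    by rewrite (leq_trans (size_polyD _ _)) // geq_max szp.
  move=> a _ [p [Ip szp <-]]; exists (a%:P * p); rewrite coefCM; split=> //.
    exact: idealM.
  by rewrite mul_polyC (leq_trans (size_scale_leq _ _)).
have LS d e a : (d <= e)%N -> L d a -> L e a.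
  move=> lede [p [Ip szp <-]]; exists ('X^(e - d) * p); split.
  - exact: idealM.
  - have [->|p0] := eqVneq p 0; first by rewrite mulr0 size_poly0.
    rewrite mulrC size_mulXn //; lia.
  - by rewrite coefXnM ltnNge leq_subr /= subKn.
have idLL : is_ideal (fun a => exists d, L d a).
  split; first by exists 0%N; apply: (ideal0 (idL 0%N)).
    move=> x y [d Ld] [e Le]; exists (maxn d e); apply: idealD => //.
      exact: LS (leq_maxl _ _) Ld.
    exact: LS (leq_maxr _ _) Le.
  by move=> a x [d Ld]; exists d; apply: idealM.
have [s sP] := noR _ idLL.
have [D DP] : exists D, forall a, a \in s -> L D a.
  have sL a : a \in s -> exists d, L d a by move=> sa; apply/sP/sub_ideal_gen.
  elim: s {sP} sL => [|a s IHs] sL; first by exists 0%N.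
  have [D DP] := IHs (fun b sb => sL b (mem_behead (s := a :: s) sb)).
  have [e Le] := sL a (mem_head _ _); exists (maxn D e) => b; rewrite inE.
  case/predU1P=> [->|/DP]; first exact: LS (leq_maxr _ _) Le.
  by move=> LD; apply: LS (leq_maxl _ _) LD.
have lift d : exists G : seq {poly R},
    (forall g, g \in G -> I g /\ (size g <= d.+1)%N) /\
    forall p, I p -> (size p <= d.+1)%N ->
      exists q, ideal_gen (fun y => y \in G) q /\ (size (p - q)%R <= d)%N /\ (size q <= d.+1)%N.
  have [t tP] := noR _ (idL d).
  have /boolp.choice[f fP] : forall a, exists p, a \in t ->
      [/\ I p, (size p <= d.+1)%N & p`_d = a].
    move=> a; have [ta|] := boolP (a \in t); last by exists 0.
    by have /tP[p pP] := sub_ideal_gen (X := fun y => y \in t) ta; exists p.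
  exists (map f t); split; first by move=> _ /mapP[a /fP[? ? _] ->].
  move=> p Ip szp; have /tP[cs [csP pd]] : L d p`_d by exists p.
  pose q := \sum_(c <- cs) c.1%:P * f c.2.
  have szq : (size q <= d.+1)%N.
    apply/leq_sizeP => j ltdj; rewrite coef_sum big_seq big1 // => c /csP /fP[_ szf _].
    by rewrite coefCM (leq_sizeP _ _ szf) ?mulr0.
  exists q; split; last split=> //.
  - rewrite /q big_seq; apply: ideal_sumr; first exact: ideal_gen_ideal.
    move=> c /csP tc; apply/(idealM _ (ideal_gen_ideal _))/sub_ideal_gen.
    exact: map_f.
  - apply: size_poly_leq_coef0.
      by rewrite (leq_trans (size_polyD _ _)) // size_polyN geq_max szp.
    rewrite coefB pd coef_sum -sumrB big_seq big1 // => c /csP /fP[_ _ fc].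
    by rewrite coefCM fc subrr.
have /boolp.choice[G GP] := lift.
pose gens := flatten [seq G d | d <- iota 0 D.+1].
have idg := ideal_gen_ideal (fun y => y \in gens).
have Gsub d q : (d <= D)%N -> ideal_gen (fun y => y \in G d) q ->
    ideal_gen (fun y => y \in gens) q.
  move=> led; apply: ideal_gen_sub => // y Gy; apply: sub_ideal_gen.
  by apply/flattenP; exists (G d) => //; apply: map_f; rewrite mem_iota.
have gI q : ideal_gen (fun y => y \in gens) q -> I q.
  apply: ideal_gen_sub => // y /flattenP[_ /mapP[d _ ->]].
  by case: (GP d) => + _ Gy => /(_ y Gy)[].
exists gens => p; split; last exact: gI.
move: {2}(size p) (leqnn (size p)) => m; elim: m p => [|m IHm] p szp Ip.
  by move: szp; rewrite leqn0 size_poly_eq0 => /eqP->; apply: ideal0.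
suff [q [Iq szq]] : exists q, ideal_gen (fun y => y \in gens) q /\ (size (p - q)%R <= m)%N.
  rewrite -(subrK q p); apply: idealD => //; apply: IHm => //.
  by apply: idealB => //; apply: gI.
(* Up to degree D the lifts in that degree cancel the leading term; above D, a combination of the
   lifts in degree D is multiplied by a power of X. *)
have [led|ltd] := leqP m D.
  by have [_ /(_ p Ip szp)[q [Gq [? _]]]] := GP m; exists q; split=> //; apply: Gsub Gq.
have /sP Lp : exists d, L d p`_m by exists m, p.
have [r [Ir szr rD]] : L D p`_m by apply: (ideal_gen_sub (idL D)) Lp.
have [_ /(_ r Ir szr)[q [Gq [szrq szq]]]] := GP D.
exists ('X^(m - D) * q); split; first by apply: idealM => //; apply: Gsub Gq.
have qD : q`_D = p`_m.
  have /leq_sizeP/(_ D (leqnn D))/eqP := szrq.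
  by rewrite coefB rD subr_eq0 => /eqP.
apply: size_poly_leq_coef0.
  rewrite (leq_trans (size_polyD _ _)) // size_polyN geq_max szp /=.
  rewrite (leq_trans (size_polyMleq _ _)) // size_polyXn /=.
  by rewrite (leq_trans (leq_add (leqnn _) szq)) // addnS subnK // ltnW.
by rewrite coefB coefXnM ltnNge leq_subr /= subKn ?qD ?subrr // ltnW.
Qed.

Lemma noetherian_generated (K R : comNzRingType) (phi : {rmorphism R -> K})
    (s : seq K) : (forall z, generated s phi z) -> noetherian R -> noetherian K.
Proof.
elim: s R phi => [|a s IHs] R phi gen noR; first exact: (noetherian_surj gen).
exact: IHs gen (hilbert_basis noR).
Qed.

Section Zariski.
Variable K : fieldType.

(* The fraction field of the image of [phi] is obtained by inverting a single
   element (Munshi's proof of the Nullstellensatz). *)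
Definition Gdomain (R : comNzRingType) (phi : {rmorphism R -> K}) : Prop :=
  exists u, phi u != 0 /\ forall b, phi b != 0 ->
    exists (N : nat) c, phi (b * c) = phi u ^+ N.

Lemma Gdomain_surj (R : comNzRingType) (phi : {rmorphism R -> K}) :
  (forall z, exists r, z = phi r) -> Gdomain phi.
Proof.
move=> surj; exists 1; rewrite rmorph1 oner_eq0; split=> // b nb.
by have [c cE] := surj (phi b)^-1; exists 0%N, c; rewrite rmorphM -cE divff.
Qed.

(** If a were transcendental over the image of [phi], evaluation at a would lose nothing, and 1 + X
    * U would divide a power of U. But it is coprime to U and not constant. *)
Lemma Gdomain_algebraic (R : comNzRingType) (phi : {rmorphism R -> K}) a :
  Gdomain (adjoin phi a) ->
  exists p, adjoin phi a p = 0 /\ map_poly phi p != 0.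
Proof.
move=> [u [nu uP]]; apply: boolp.contrapT => noalg.
have inj p : adjoin phi a p = 0 -> map_poly phi p = 0.
  by move=> p0; apply: boolp.contrapT => /eqP np; apply: noalg; exists p.
pose U := map_poly phi u; pose V := 1 + 'X * U.
have VE : map_poly phi (1 + 'X * u) = V by rewrite rmorphD rmorphM rmorph1 /= map_polyX.
have nU : U != 0.
  by apply: contraNneq nu => U0; rewrite adjoinE -/U U0 horner0.
have nV : adjoin phi a (1 + 'X * u) != 0.
  apply/eqP => /inj; rewrite VE => /polyP/(_ 0%N)/eqP.
  by rewrite coefD coef1 coefXM addr0 coef0 oner_eq0.
have [N [c]] := uP _ nV; move/eqP; rewrite -rmorphXn -subr_eq0 -rmorphB => /eqP/inj.
rewrite rmorphB rmorphM rmorphXn /= VE => /eqP; rewrite subr_eq0 => /eqP VU.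
have cop : coprimep V U.
  apply/Bezout_eq1_coprimepP; exists (1, - 'X); rewrite /= /V; ring.
have : V %| U ^+ N by rewrite -VU dvdp_mulIl.
have /coprimepP/(_ V (dvdpp _)) H := coprimep_expr N cop.
move/H; rewrite -size_poly_eq1 /V addrC size_polyDl ?size_poly1 mulrC size_mulX //.
  by rewrite eqSS size_poly_eq0 (negPf nU).
by rewrite ltnS lt0n size_poly_eq0.
Qed.

Lemma adjoin_inv_den (R : comNzRingType) (phi : {rmorphism R -> K}) c g :
  phi c != 0 -> exists (s : nat) r, adjoin phi (phi c)^-1 g * phi c ^+ s = phi r.
Proof.
move=> nc; elim/poly_ind: g => [|g b [s [r grE]]].
  by exists 0%N, 0; rewrite !rmorph0 mul0r.
exists s.+1, (r + b * c ^+ s.+1).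
rewrite !rmorphD !rmorphM rmorphXn adjoinX adjoinC mulrDl -grE.
by rewrite [in LHS]exprS [X in X + _]mulrA mulfVK // -exprS.
Qed.

(** The element a is a root of a polynomial with leading coefficient c over the image of [phi], so
    everything in the image of R[a] becomes integral once c is inverted. Integral equations then
    carry inverses from that image down to the image of R, with powers of c as denominators. *)
Lemma Gdomain_base (R : comNzRingType) (phi : {rmorphism R -> K}) a :
  Gdomain (adjoin phi a) -> Gdomain phi.
Proof.
move=> Da; have [p [pa np]] := Gdomain_algebraic Da.
have [u [nu uP]] := Da.
pose P := map_poly phi p; pose c := p`_(size P).-1.
have cE : phi c = lead_coef P by rewrite lead_coefE coef_map.
have nc : phi c != 0 by rewrite cE lead_coef_eq0.
pose psi := adjoin phi (phi c)^-1.
have psiC r : psi r%:P = phi r by apply: adjoinC.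
have inta : integralOver psi a.
  apply: (@integral_root_monic _ _ _ _ ((phi c)^-1 *: P)).
  - by rewrite monicE lead_coefZ -cE mulVf.
  - by rewrite /root hornerZ -adjoinE pa mulr0.
  apply/integral_poly => i; rewrite coefZ coef_map.
  have -> : (phi c)^-1 * phi p`_i = psi ('X * (p`_i)%:P) by rewrite rmorphM psiC [psi _]adjoinX.
  exact: integral_id.
have intA f : integralOver psi (adjoin phi a f).
  apply: integral_horner inta; apply/integral_poly => i.
  have -> : (map_poly phi f)`_i = psi (f`_i)%:P by rewrite psiC coef_map.
  exact: integral_id.
set w := adjoin phi a u in nu uP.
(* As w is nonzero, factors X can be split off an integral equation of w until its constant
   coefficient is nonzero. *)
have [f [monf fw nf0]] : exists f : {poly {poly R}},
    [/\ f \is monic, root (map_poly psi f) w & psi f`_0 != 0].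
  have [f] := intA u; elim/poly_ind: f => [|f b IHf].
    by rewrite monicE lead_coef0 eq_sym oner_eq0.
  move=> monf fw; have [b0|nb] := eqVneq (psi b) 0; last first.
    exists (f * 'X + b%:P); split=> //.
    by rewrite coefD coefMX coefC add0r.
  have [f0|nf] := eqVneq f 0.
    move: monf b0; rewrite f0 mul0r add0r monicE lead_coefC => /eqP ->.
    by rewrite rmorph1 => /eqP; rewrite oner_eq0.
  apply: IHf.
    move: monf; rewrite !monicE lead_coefDl ?lead_coefMX //.
    rewrite size_mulX // ltnS (leq_trans (size_polyC_leq1 _)) //.
    by rewrite lt0n size_poly_eq0.
  move: fw; rewrite rmorphD rmorphM /= map_polyX map_polyC /= b0 addr0.
  by rewrite rootM rootX (negPf nu) orbF.
pose g := - f`_0; have ng : psi g != 0 by rewrite rmorphN oppr_eq0.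
(* Writing F = F' * X + F_0, the relation F(w) = 0 says that w * F'(w) = - F_0, which is the image
   of g. *)
have [z zw intz] : exists2 z, w * z = psi g & integralOver psi z.
  pose F := map_poly psi f.
  pose F' := \poly_(i < size F) F`_i.+1.
  have FE : F = F' * 'X + (F`_0)%:P.
    apply/polyP => -[|i]; rewrite coefD coefMX coefC /= ?add0r // addr0 [RHS]coef_poly.
    by case: ltnP => // lei; rewrite nth_default // leqW.
  exists F'.[w].
    move: fw; rewrite /root -/F FE hornerD hornerMX hornerC coef_map.
    by rewrite addr_eq0 => /eqP fw; rewrite mulrC fw rmorphN.
  apply: integral_horner (intA u); apply/integral_poly => i; rewrite coef_poly.
  by case: ifP => _; [rewrite coef_map; apply: integral_id | apply: integral0].
have [sg [rg rgE]] := adjoin_inv_den g nc.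
(* The element to invert combines the denominator c with [rg], the numerator of g. *)
exists (c * rg); split.
  by rewrite rmorphM mulf_eq0 negb_or nc -rgE mulf_neq0 // expf_neq0.
move=> b nb; have [N [e beE]] : exists (N : nat) e, adjoin phi a (b%:P * e) = w ^+ N.
  by apply: uP; rewrite adjoinC.
pose y := adjoin phi a e * z ^+ N.
have byE : phi b * y = psi g ^+ N.
  by rewrite -zw exprMn -beE rmorphM adjoinC mulrA.
have : integralOver psi y.
  apply: integral_mul => //; elim: (N) => [|m IHm]; first exact: integral1.
  by rewrite exprS; apply: integral_mul.
case=> q monq qy.
have [m szq] : exists m, size q = m.+2.
  case E: (size q) => [|[|m]]; last by exists m.
    by have := monic_neq0 monq; rewrite -size_poly_eq0 E.
  have q1 : q = 1.
    have qC := size1_polyC (eq_leq E); move: monq.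
    by rewrite qC monicE lead_coefC => /eqP->.
  by move: qy; rewrite q1 rmorph1 (negPf (root1 _)).
(* With q monic of degree m + 1 and b * y = g ^+ N, multiplying q(y) = 0 by b ^+ m.+1 and factoring
   out one b gives b * h = g ^+ (N * m.+1). *)
pose h := - \sum_(i < m.+1) q`_i * g ^+ (N * i) * b%:P ^+ (m - i).
have bhE : phi b * psi h = psi g ^+ (N * m.+1).
  have : phi b ^+ m.+1 * (map_poly psi q).[y] = 0 by rewrite (eqP qy) mulr0.
  rewrite horner_coef size_map_poly_id0; last first.
    by rewrite (eqP monq) rmorph1 oner_eq0.
  rewrite szq big_ord_recr /= mulrDr.
  have -> : (map_poly psi q)`_m.+1 = 1.
    have qm : q`_m.+1 = 1 by move: monq; rewrite monicE lead_coefE szq => /eqP.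
    by rewrite coef_map qm; apply: (rmorph1 psi).
  rewrite mul1r -exprMn byE -exprM => /eqP; rewrite addrC addr_eq0 => /eqP ->.
  rewrite rmorphN mulrN rmorph_sum !mulr_sumr; congr (- _); apply: eq_bigr => i _.
  rewrite coef_map !rmorphM !rmorphXn psiC exprM -byE.
  have -> : phi b ^+ m.+1 = phi b * phi b ^+ (m - i) * phi b ^+ i.
    by rewrite -mulrA -exprD subnK ?exprS // -ltnS.
  by rewrite exprMn; ring.
have [s [r rE]] := adjoin_inv_den h nc.
pose M := (N * m.+1)%N.
(* After clearing denominators, b * r = g^M * c^s and g^M * c^(sg * M) = rg^M; the remaining factors
   complete the power of c * rg to the exponent M + s. *)
exists (M + s)%N, (r * rg ^+ s * c ^+ (sg * M + M)).
rewrite !rmorphM !rmorphXn -rE -rgE mulrA.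
have -> : phi b * (psi h * phi c ^+ s * (psi g * phi c ^+ sg) ^+ s) =
          (phi b * psi h) * phi c ^+ s * (psi g * phi c ^+ sg) ^+ s by ring.
rewrite bhE -/M !exprMn !exprD !exprM; ring.
Qed.

Lemma generated_Gdomain (R : comNzRingType) (phi : {rmorphism R -> K}) s :
  (forall z, generated s phi z) -> Gdomain phi.
Proof.
elim: s R phi => [|a s IHs] R phi gen; first exact: Gdomain_surj.
exact/Gdomain_base/IHs/gen.
Qed.

(** Descending through the other generators, the image of k[X] under evaluation at a is still a
    G-domain, so a is algebraic over k. *)
Lemma zariski (k : fieldType) (phi : {rmorphism k -> K}) a s :
  (forall z, generated s (adjoin phi a) z) ->
  exists2 q : {poly k}, q \is monic & (map_poly phi q).[a] = 0.
Proof.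
move=> /generated_Gdomain/Gdomain_algebraic[p [pa np]].
have np0 : p != 0 by apply: contraNneq np => ->; rewrite rmorph0.
exists ((lead_coef p)^-1 *: p).
  by rewrite monicE lead_coefZ mulVf ?lead_coef_eq0.
by rewrite map_polyZ hornerZ -adjoinE pa mulr0.
Qed.

End Zariski.

(** * Chains of primes in polynomial rings *)

Section Dimension.
Variables (k : fieldType) (n : nat).
Local Notation S := {mpoly k[n]}.
Implicit Types (I J P Q : S -> Prop) (p q : S).

Lemma ideal_scale I (c : k) p : is_ideal I -> I p -> I (c *: p).
Proof. by move=> idI Ip; rewrite -mul_mpolyC; apply: idealM. Qed.

Definition deg_le (L : nat) p := forall m, m \in msupp p -> (mdeg m <= L)%N.

Lemma deg_le1 : deg_le 0 1.
Proof. by move=> m; rewrite msupp1 inE => /eqP->; rewrite mdeg0. Qed.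

Lemma deg_leM L L' p q : deg_le L p -> deg_le L' q -> deg_le (L + L') (p * q).
Proof.
move=> pL qL m /msuppM_le/allpairsP[[m1 m2] /= [/pL le1 /qL le2 ->]].
by rewrite mdegD leq_add.
Qed.

Lemma deg_leX L p a : deg_le L p -> deg_le (a * L) (p ^+ a).
Proof.
move=> pL; elim: a => [|a IHa]; first exact: deg_le1.
by rewrite exprS mulSn; apply: deg_leM.
Qed.

Lemma deg_leW L L' p : (L <= L')%N -> deg_le L p -> deg_le L' p.
Proof. by move=> le pL m /pL h; apply: leq_trans le. Qed.

Lemma deg_le_msize p : deg_le (msize p) p.
Proof. by move=> m /msize_mdeg_lt/ltnW. Qed.

Definition free_mod Q (I : finType) (f : I -> S) : Prop :=
  forall c : I -> k, Q (\sum_i c i *: f i) -> forall i, c i = 0.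

(** In a relation modulo Q, the lowest power of y that occurs can be cancelled because Q is prime
    and y is not in Q. Reduction modulo Q', where y vanishes, then leaves a relation among the f
    i. *)
Lemma free_mod_powers Q Q' y N (I : finType) (f : I -> S) :
  is_prime Q -> is_ideal Q' -> (forall x, Q x -> Q' x) -> Q' y -> ~ Q y ->
  free_mod Q' f ->
  free_mod Q (fun ai : 'I_N * I => y ^+ ai.1 * f ai.2).
Proof.
move=> [idQ Q1 QM] idQ' QQ' Q'y nQy ff c Qc.
pose g b := \sum_i c (b, i) *: f i.
have Qg : Q (\sum_(b < N) y ^+ b * g b).
  move: Qc; congr Q; symmetry.
  under eq_bigr => b _ do rewrite mulr_sumr.
  by rewrite pair_bigA; apply: eq_bigr => -[b i] _ /=; rewrite scalerAr.
suff c0 m (a : 'I_N) : (a < m)%N -> forall i, c (a, i) = 0.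
  by case=> a i; apply: (c0 a.+1).
elim: m a => [//|m IHm] a; rewrite ltnS leq_eqVlt => /predU1P[am|]; last exact: IHm.
have gb0 (b : 'I_N) : (b < a)%N -> g b = 0.
  by rewrite am => ltb; apply: big1 => i _; rewrite IHm ?scale0r.
have Qh : Q (\sum_(b < N) y ^+ (b - a) * g b).
  have nQya : ~ Q (y ^+ a).
    by elim: (nat_of_ord a) => [|e IHe]; rewrite ?expr0 // exprS => /QM[].
  have : Q (y ^+ a * \sum_(b < N) y ^+ (b - a) * g b).
    move: Qg; congr Q; rewrite mulr_sumr; apply: eq_bigr => b _.
    have [ltb|leb] := ltnP b a; first by rewrite gb0 // !mulr0.
    by rewrite mulrA -exprD subnKC.
  by case/QM.
apply: (ff (fun i => c (a, i))); rewrite -/(g a).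
move: Qh => /QQ'; rewrite (bigD1 a) //= subnn mul1r => Q'h.
suff Q's : Q' (\sum_(i < N | i != a) y ^+ (i - a) * g i).
  by have := idealB idQ' Q'h Q's; rewrite addrK.
apply: ideal_sumr => // b nba.
case: (ltngtP b a) => [ltb|gtb|eqb]; first by rewrite gb0 // mulr0; apply: ideal0.
  by rewrite -(subnSK gtb) exprS -mulrA; apply: idealMx.
by case/eqP: nba; apply: val_inj.
Qed.

Definition prime_chain (C : nat -> S -> Prop) (h : nat) : Prop :=
  (forall i, (i <= h)%N -> is_prime (C i)) /\
  forall i, (i < h)%N ->
    (forall x, C i x -> C i.+1 x) /\ (exists x, C i.+1 x /\ ~ C i x).

(** Each step of the chain contributes N powers of one element. The point is that D does not depend
    on N: there are N^h independent elements whose degrees grow only linearly in N. *)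
Lemma free_mod_chain C h : prime_chain C h ->
  exists D : nat, forall N, exists (I : finType) (f : I -> S),
    [/\ #|I| = (N ^ h)%N, free_mod (C 0%N) f
      & forall i, deg_le (N * D) (f i)].
Proof.
elim: h C => [|h IHh] C [prC subC].
  exists 0%N => N; exists unit, (fun=> 1); split=> [|c|_]; first by rewrite card_unit.
    have [idC C1 _] := prC 0%N (leqnn _).
    rewrite (big_pred1 tt) => [Cc []|[] //].
    apply: boolp.contrapT => /eqP nc; apply: C1.
    by rewrite -[1]scale1r -(mulVf nc) -scalerA; apply: ideal_scale.
  by rewrite muln0; apply: deg_le1.
have [|D DP] := IHh (fun i => C i.+1).
  by split=> i lei; [apply: prC | apply: subC].
have [C01 [y [C1y nC0y]]] := subC 0%N (ltn0Sn _).
exists (msize y + D)%N => N; have [I [f [cI ff fD]]] := DP N.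
exists ('I_N * I)%type, (fun ai : 'I_N * I => y ^+ ai.1 * f ai.2); split.
- by rewrite card_prod card_ord cI expnS.
- apply: free_mod_powers ff => //; first exact: prC.
  by have [] := prC 1%N (ltn0Sn _).
- move=> [a i] /=; rewrite mulnDr; apply: deg_leM (fD i).
  apply: (deg_leW _ (deg_leX (a := a) (deg_le_msize (p := y)))).
  by rewrite leq_mul2r ltnW ?orbT.
Qed.

Lemma ideal_of_msupp I p : is_ideal I ->
  (forall m, m \in msupp p -> I 'X_[m]) -> I p.
Proof.
move=> idI pI; rewrite [p]mpolyE big_seq; apply: ideal_sumr => // m mp.
by apply: ideal_scale => //; apply: pI.
Qed.

Lemma ideal_mnm_var I (m : 'X_{1..n}) i : is_ideal I -> I 'X_i -> (0 < m i)%N -> I 'X_[m].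
Proof.
move=> idI Ii mi.
rewrite -(@submK _ U_(i)%MM m); first by rewrite mpolyXD; apply: idealM.
by apply/mnm_lepP => j; rewrite mnm1E; case: eqP => // <-.
Qed.

(** Modulo the first prime only monomials in the variables of F matter. Those of degree at most N *
    D number at most (N * D + 1)^|F|, which for large N is less than the N^(|F| + 1) independent
    elements given by a longer chain. *)
Lemma chain_length C h (F : {set 'I_n}) : prime_chain C h ->
  (forall i, i \notin F -> C 0%N 'X_i) -> (h <= #|F|)%N.
Proof.
move=> [prC subC] CF; rewrite leqNgt; apply/negP => ltFh.
set d := #|F| in ltFh.
have [|D DP] := @free_mod_chain C d.+1.
  by split=> i lei; [apply: prC | apply: subC]; apply: leq_trans lei ltFh.
(* With this N, (N * D + 1)^d is at most (N * B)^d = N^d * B^d, which is less than N^(d + 1). *)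
pose B := D.+1; pose N := (B ^ d).+1; have [I [f [cI ff fD]]] := DP N.
have [idC C1 _] := prC 0%N (leq0n _).
pose L := (N * D)%N.
pose T := [set g : {ffun 'I_n -> 'I_L.+1} | [forall i, (i \notin F) ==> (g i == ord0)]].
have cT : (#|T| = L.+1 ^ d)%N.
  rewrite -[L.+1 in RHS]card_ord -(card_pffun_on ord0 F predT).
  apply: eq_card => g; rewrite inE; apply/forallP/pffun_onP => [gF|[/supportP gF _] i].
    split=> //; apply/supportP => i iF; apply/eqP.
    by have /implyP := gF i; apply.
  by apply/implyP => iF; rewrite gF.
have ltTI : (#|T| < #|I|)%N.
  rewrite cT cI; apply: (@leq_ltn_trans ((N * B) ^ d)%N).
    have leLB : (L < N * B)%N by rewrite /L /B mulnS -add1n leq_add2r.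
    by elim: (d) => // e IHe; rewrite !expnS leq_mul.
  by rewrite expnMn expnSr ltn_pmul2l ?expn_gt0.
pose mon (g : {ffun 'I_n -> 'I_L.+1}) := [multinom (g i : nat) | i < n].
(* The rows are the coefficients of the f i at monomials supported in F. There are more rows than
   columns, so some nontrivial combination of the f i has only monomials that involve a variable
   outside F. *)
pose A := \matrix_(i < #|I|, t < #|T|) (f (enum_val i))@_(mon (enum_val t)).
have : ~~ row_free A.
  by apply/negP => /eqP rA; have := rank_leq_col A; rewrite rA leqNgt ltTI.
rewrite -kermx_eq0 => /rowV0Pn[v /sub_kermxP vA nv].
case/eqP: nv; apply/rowP => j; rewrite mxE -(enum_valK j).
apply: (ff (fun i => v 0 (enum_rank i))).
apply: ideal_of_msupp => // m mS.
have [[i [iF mi]]|noi] := boolp.pselect (exists i, i \notin F /\ (0 < m i)%N).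
  by apply: ideal_mnm_var mi => //; apply: CF.
have mL i : (m i < L.+1)%N.
  have /hasP[j' _ mj] : has (fun i => m \in msupp (v 0 (enum_rank i) *: f i)) (enum I).
    apply/negPn/negP => /hasPn H; move: mS; rewrite mcoeff_msupp raddf_sum /= big1 ?eqxx //.
    by move=> i' _; apply/memN_msupp_eq0/H; rewrite mem_enum.
  have /fD := msuppZ_le mj; rewrite mdegE (bigD1 i) //= => le.
  by rewrite ltnS (leq_trans _ le) // leq_addr.
pose g : {ffun 'I_n -> 'I_L.+1} := [ffun i => Ordinal (mL i)].
have gT : g \in T.
  rewrite inE; apply/forallP => i; apply/implyP => iF; rewrite ffunE -val_eqE /=.
  by rewrite -leqn0 leqNgt; apply/negP => mi; apply: noi; exists i.
have gm : mon g = m by apply/mnmP => i; rewrite mnmE ffunE.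
move/rowP/(_ (enum_rank_in gT g)): vA; rewrite !mxE => vA0.
move: mS; rewrite mcoeff_msupp => /eqP[]; rewrite raddf_sum /= -[RHS]vA0.
rewrite (reindex (@enum_val I predT)) /=; last first.
  by apply: onW_bij; apply: enum_val_bij.
apply: eq_bigr => i _; rewrite !mxE enum_rankK_in // gm mcoeffZ enum_valK.
by [].
Qed.

End Dimension.

(** * Weakly regular sequences modulo monomial ideals *)

(** Descending induction on j: in the coefficient of f * p in degree j + deg f, the leading term of
    f contributes the coefficient of p in degree j, and all other terms involve higher coefficients
    of p. *)
Lemma monic_coef_ideal (R : comNzRingType) (J : R -> Prop) (f p : {poly R}) :
  is_ideal J -> f \is monic -> (forall j, J (f * p)`_j) -> forall j, J p`_j.
Proof.
move=> idJ monf Jfp j.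
move: {2}(size p - j)%N (leqnn (size p - j)) => m; elim: m j => [|m IHm] j le.
  by rewrite nth_default; [apply: ideal0 | rewrite -subn_eq0 -leqn0].
have Jgt j' : (j < j')%N -> J p`_j' by move=> ltj; apply: IHm; lia.
have fe : f`_(size f).-1 = 1 by apply/eqP; rewrite -lead_coefE -monicE.
have lte : ((size f).-1 < (j + (size f).-1).+1)%N by lia.
have := Jfp (j + (size f).-1)%N; rewrite coefM (bigD1 (Ordinal lte)) //= fe mul1r addnK.
move=> H; rewrite -[p`_j](addrK (\sum_(i < (j + (size f).-1).+1 | i != Ordinal lte)
  f`_i * p`_(j + (size f).-1 - i))); apply: idealB => //.
apply: ideal_sumr => // i ni.
have [lti|lei] := ltnP i (size f).-1; first by apply: idealM => //; apply: Jgt; lia.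
have nie : (i : nat) != (size f).-1 by apply: contraNneq ni => ie; apply/eqP/val_inj.
have ltfi : ((size f).-1 < i)%N by rewrite ltn_neqAle eq_sym nie.
have -> : f`_i = 0 by rewrite nth_default // (leq_trans (leqSpred _) ltfi).
by rewrite mul0r; apply: ideal0.
Qed.

(** * Elementary symmetric polynomials as a weakly regular sequence *)

Section RegularSequence.
Variables (k : fieldType) (n : nat).
Local Notation S := {mpoly k[n]}.
Implicit Types (J : S -> Prop) (p : S) (G : {set 'I_n}).

Definition uni (i : 'I_n) (q : {poly k}) : S := (map_poly (@mpolyC n k) q).['X_i].

(** Reads p as a polynomial in x_i. The coefficients are kept in S, not in a ring with one variable
    fewer, so that ideals of S apply to them. *)
Definition expand (i : 'I_n) : S -> {poly S} :=
  mmap (polyC \o @mpolyC n k) (fun j => if j == i then 'X else ('X_j)%:P).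

HB.instance Definition _ i := GRing.RMorphism.copy (expand i) (expand i).

Lemma expandX i j : expand i 'X_j = if j == i then 'X else ('X_j)%:P.
Proof. by rewrite /expand mmapX mmap1U. Qed.

Lemma expandC i c : expand i c%:MP = (c%:MP)%:P.
Proof. by rewrite /expand mmapC. Qed.

Lemma expandK i p : (expand i p).['X_i] = p.
Proof.
rewrite {2}[p]mpolyE /expand /mmap horner_sum; apply: eq_bigr => m _.
rewrite /= hornerM hornerC mul_mpolyC (mpolyXE_id _ m) /mmap1 horner_prod; congr (_ *: _).
by apply: eq_bigr => j _; rewrite horner_exp; case: eqP => [->|_]; rewrite ?hornerX ?hornerC.
Qed.

Lemma expand_uni i q : expand i (uni i q) = map_poly (@mpolyC n k) q.
Proof.
rewrite /uni; elim/poly_ind: q => [|q c IHq]; first by rewrite rmorph0 horner0 rmorph0.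
rewrite !rmorphD !rmorphM /= map_polyX map_polyC /= hornerD hornerM hornerX hornerC.
by rewrite rmorphD rmorphM /= IHq expandX eqxx expandC.
Qed.

Lemma expand_uni_neq i j q : j != i -> expand i (uni j q) = (uni j q)%:P.
Proof.
move=> nji; rewrite /uni; elim/poly_ind: q => [|q c IHq].
  by rewrite rmorph0 horner0 !rmorph0.
rewrite !rmorphD !rmorphM /= map_polyX map_polyC /= hornerD hornerM hornerX hornerC.
by rewrite rmorphD rmorphM /= IHq expandX (negPf nji) expandC polyCD polyCM.
Qed.

(** The ideal (z_i : i outside G). When z consists of the variables, the quotient is k[x_G]. *)
Definition famI (z : 'I_n -> S) G : S -> Prop := fun x =>
  exists a : 'I_n -> S, x = \sum_(i | i \notin G) a i * z i.

Lemma famI_ideal z G : is_ideal (famI z G).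
Proof.
split.
- by exists (fun=> 0); rewrite big1 // => i _; rewrite mul0r.
- move=> _ _ [a ->] [b ->]; exists (fun i => a i + b i).
  by rewrite -big_split; apply: eq_bigr => i _; rewrite mulrDl.
- move=> c _ [a ->]; exists (fun i => c * a i).
  by rewrite mulr_sumr; apply: eq_bigr => i _; rewrite mulrA.
Qed.

Lemma famI_mem z G i : i \notin G -> famI z G (z i).
Proof.
move=> iG; exists (fun j => (j == i)%:R); rewrite (bigD1 i) //= eqxx mul1r.
by rewrite big1 ?addr0 // => j /andP[_ /negPf ->]; rewrite mul0r.
Qed.

(** The generators z j with j outside G do not involve x_i, so membership in the ideal can be tested
    on the coefficients with respect to x_i, where [monic_coef_ideal] applies. *)
Lemma famI_uni_nzd z G i q p : i \in G -> (forall j, exists r, z j = uni j r) ->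
  q \is monic -> famI z G (uni i q * p) -> famI z G p.
Proof.
move=> iG zu monq Jqp; have idJ := famI_ideal z G.
have Jexp x : famI z G x -> forall t, famI z G (expand i x)`_t.
  case=> a -> t; rewrite rmorph_sum coef_sum /=; apply: ideal_sumr => // j jG.
  have [r zj] := zu j; have nji : j != i by apply: contraNneq jG => ->.
  rewrite rmorphM /= zj expand_uni_neq // -zj mulrC coefCM.
  by apply: idealMx => //; apply: famI_mem.
have Jp t : famI z G (expand i p)`_t.
  apply: (@monic_coef_ideal _ _ (expand i (uni i q))) => //.
    by rewrite expand_uni map_monic.
  by move=> t'; rewrite -rmorphM; apply: Jexp.
by rewrite -(expandK i p) horner_coef; apply: ideal_sumr => // t _; apply: idealMx.
Qed.

Variable Y : 'I_n -> {poly k}.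
Hypothesis monY : forall i, Y i \is monic.
Let y i := uni i (Y i).

Definition esum_prod (r : nat) : S := \sum_(A : {set 'I_n} | #|A| == r) \prod_(i in A) y i.

Fixpoint esum_seq (m : nat) : seq S :=
  if m is m'.+1 then esum_prod m :: esum_seq m' else [::].

Lemma size_esum_seq m : size (esum_seq m) = m.
Proof. by elim: m => //= m ->. Qed.

Lemma esum_seq_mem J m : is_ideal J -> (forall i, J (y i)) ->
  forall x, x \in esum_seq m -> J x.
Proof.
move=> idJ Jy x; elim: m => //= m IHm; rewrite inE => /orP[/eqP->|]; last exact: IHm.
apply: ideal_sumr => // A /eqP cA.
have /card_gt0P[i iA] : (0 < #|A|)%N by rewrite cA.
by rewrite (bigD1 i) //=; apply: idealMx.
Qed.

(** Any other set with as many elements as G has an element outside G, so its product lies in J. *)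
Lemma esum_prod_mod J G : is_ideal J -> (forall i, i \notin G -> J (y i)) ->
  J (esum_prod #|G| - \prod_(i <- enum G) y i).
Proof.
move=> idJ Jy; rewrite /esum_prod (bigD1 G) //= big_enum /= addrAC subrr add0r.
apply: ideal_sumr => // A /andP[/eqP cA nAG].
have /subsetPn[i iA iG] : ~~ (A \subset G).
  by apply: contra nAG => sAG; rewrite eqEcard sAG cA leqnn.
by rewrite (bigD1 i) //=; apply: idealMx => //; apply: Jy.
Qed.

(* The last [m] elementary symmetric polynomials in the [y i]: modulo the
   [y i] with [i] outside of [G], the first one is the product of the [y i] over
   [G], and killing one of these factors brings us back to [m - 1]. *)
Lemma esum_seq_wreg m G z : #|G| = m ->
  (forall i, exists r, z i = uni i r) ->
  (forall i, i \notin G -> exists b, y i = b * z i) ->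
  wreg (famI z G) (esum_seq m).
Proof.
elim: m G z => [|m IHm] G z cG zu yz //=.
have idJ := famI_ideal z G; set J := famI z G in idJ *.
have Jy i : i \notin G -> J (y i).
  by move=> iG; have [b ->] := yz i iG; apply: idealM => //; apply: famI_mem.
have nzy i x : i \in G -> J (y i * x) -> J x.
  by move=> iG; apply: (famI_uni_nzd iG zu (monY i)).
have eG := esum_prod_mod idJ Jy; rewrite cG in eG.
split.
  move=> x Jex; have : J ((\prod_(i <- enum G) y i) * x).
    set e := esum_prod m.+1 in eG Jex; set P := \prod_(i <- enum G) y i in eG *.
    have -> : P * x = e * x - (e - P) * x by ring.
    by apply: idealB => //; apply: idealMx.
  have : {subset enum G <= G} by move=> i; rewrite mem_enum.
  elim: (enum G) => [|i s IHs] sG; first by rewrite big_nil mul1r.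
  rewrite big_cons -mulrA => /nzy H; apply: IHs; last by apply/H/sG/mem_head.
  by move=> j js; apply: sG; rewrite inE js orbT.
(* Modulo J the elementary symmetric polynomial may be replaced by the product over G, whose factors
   are now split off one at a time. For the empty product the ideal is the whole ring. *)
suff key s : {subset s <= G} -> wreg (addI J (\prod_(i <- s) y i)) (esum_seq m).
  apply: (eq_wreg _ (key (enum G) _)); last by move=> i; rewrite mem_enum.
  set e := esum_prod m.+1 in eG *; set P := \prod_(i <- enum G) y i in eG *.
  move=> x; split=> -[a Ja]; exists a.
    have -> : x - e * a = (x - P * a) - (e - P) * a by ring.
    by apply: idealB => //; apply: idealMx.
  have -> : x - P * a = (x - e * a) + (e - P) * a by ring.
  by apply: idealD => //; apply: idealMx.
elim: s => [|h s IHs] sG.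
  apply: wreg1; first exact: addI_ideal.
  by rewrite big_nil -[X in addI _ _ X]mulr1; apply: addI_gen.
have hG : h \in G by apply/sG/mem_head.
apply: (@wreg_filter _ _ (y h)); first exact: addI_ideal.
  apply: eq_wreg (IHs _); last by move=> j js; apply: sG; rewrite inE js orbT.
  move=> x; rewrite big_cons /colonI; split=> -[a Ja]; exists a.
    by rewrite -mulrA -mulrBr; apply: idealM.
  by apply: (nzy h) => //; rewrite mulrBr mulrA.
(* Adding y h to the ideal makes it the ideal of a family again, with h moved out of G and y h as
   the new generator there. *)
pose z' i := if i == h then y h else z i.
apply: (eq_wreg _ (IHm (G :\ h) z' _ _ _)).
- have idJ' : is_ideal (addI (addI J (\prod_(i <- h :: s) y i)) (y h)).
    by do 2! apply: addI_ideal.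
  move=> x; split.
    case=> a ->; apply: ideal_sumr => // i; rewrite !inE negb_and negbK => iG.
    apply: idealM => //; rewrite /z'; case: eqP iG => [-> _|_ /= iG].
      by rewrite -[X in addI _ _ X]mulr1; apply: addI_gen; apply: addI_ideal.
    by do 2! apply: addI_sub; apply: famI_mem.
  have idF := famI_ideal z' (G :\ h).
  have Fy : famI z' (G :\ h) (y h).
    by have := @famI_mem z' (G :\ h) h; rewrite /z' eqxx; apply; rewrite !inE eqxx.
  apply: addI_min => // w; apply: addI_min => //; last first.
    by rewrite big_cons; apply: idealMx.
  move=> _ [a ->]; apply: ideal_sumr => // i iG; apply: idealM => //.
  have nih : i != h by apply: contraNneq iG => ->.
  have := @famI_mem z' (G :\ h) i; rewrite /z' (negPf nih); apply.
  by rewrite !inE negb_and iG orbT.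
- by move: cG; rewrite (cardsD1 h) hG => -[].
- by move=> i; rewrite /z'; case: eqP => [->|_]; [exists (Y h) | apply: zu].
- move=> i; rewrite !inE negb_and negbK /z'; case: eqP => [-> _|_ /= /yz //].
  by exists 1; rewrite mul1r.
Qed.

End RegularSequence.

(** * The filtration of a monomial quotient *)

Section MonomialFiltration.
Variables (k : fieldType) (n : nat).
Local Notation S := {mpoly k[n]}.
Implicit Types (Q : 'X_{1..n} -> Prop) (p : S) (m u : 'X_{1..n}) (B F s : {set 'I_n}).

Definition monI Q : S -> Prop := fun p => forall m, m \in msupp p -> Q m.

Definition up_closed Q := forall m m', Q m -> Q (m' + m)%MM.

Lemma monI_ideal Q : up_closed Q -> is_ideal (monI Q).
Proof.
move=> upQ; split.
- by move=> m; rewrite msupp0.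
- by move=> p q Qp Qq m /msuppD_le; rewrite mem_cat => /orP[/Qp|/Qq].
- move=> a p Qp m /msuppM_le/allpairsP[[m1 m2] /= [_ /Qp Qm2 ->]].
  exact: upQ.
Qed.

Lemma eq_monI Q Q' : (forall m, Q m <-> Q' m) -> forall p, monI Q p <-> monI Q' p.
Proof. by move=> eqQ p; split=> Qp m /Qp/eqQ. Qed.

Lemma monIX Q m : monI Q 'X_[m] <-> Q m.
Proof.
split=> [|Qm m']; first by apply; rewrite msuppX mem_head.
by rewrite msuppX inE => /eqP->.
Qed.

Lemma colon_monI Q i p :
  colonI (monI Q) 'X_i p <-> monI (fun m => Q (U_(i) + m)%MM) p.
Proof.
rewrite /colonI /monI mulrC; split=> H m.
  by move=> mp; apply: H; rewrite (perm_mem (msuppMX _ _)); apply: map_f.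
by rewrite (perm_mem (msuppMX _ _)) => /mapP[m' /H Qm' ->].
Qed.

Lemma add_monI Q i p : up_closed Q ->
  addI (monI Q) 'X_i p <-> monI (fun m => Q m \/ (0 < m i)%N) p.
Proof.
move=> upQ; have idQ := monI_ideal upQ; split.
  case=> a Qa m mp.
  have [/Qa|] := boolP (m \in msupp (p - 'X_i * a)); first by left.
  rewrite mcoeff_msupp negbK mcoeffB subr_eq0 => /eqP pm; right; move: mp.
  rewrite mcoeff_msupp pm -mcoeff_msupp mulrC (perm_mem (msuppMX _ _)).
  by case/mapP=> m' _ ->; rewrite mnmDE mnm1E eqxx.
move=> Hp; apply: ideal_of_msupp; first exact: addI_ideal.
move=> m /Hp[Qm|mi]; first by apply/addI_sub/monIX.
apply: (@ideal_mnm_var k n _ m i) => //; first exact: addI_ideal.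
by rewrite -[X in addI _ _ X]mulr1; apply: addI_gen.
Qed.

Lemma monI_vars F p :
  monI (fun m => exists2 i, i \notin F & (0 < m i)%N) p <-> famI (fun i => 'X_i) F p.
Proof.
have idF := @famI_ideal k n (fun i => 'X_i) F; split.
  move=> Hp; apply: ideal_of_msupp => // m /Hp[i iF mi].
  by apply: ideal_mnm_var mi => //; apply: famI_mem.
case=> a ->; apply: ideal_sumr.
  by apply: monI_ideal => m m' [i iF mi]; exists i => //; rewrite mnmDE ltn_addl.
move=> i iF m; rewrite (perm_mem (msuppMX _ _)) => /mapP[m' _ ->].
by exists i => //; rewrite mnmDE mnm1E eqxx.
Qed.

Variables (Sg : {set {set 'I_n}}) (e : {set 'I_n} -> nat) (r : nat).

Definition in_gens (b : 'X_{1..n}) : Prop :=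
  exists2 s, s \in Sg & forall i, i \in s -> (e s <= b i)%N.

Lemma in_gens_up : up_closed in_gens.
Proof.
move=> m m' [s sS H]; exists s => // i /H; rewrite mnmDE => le.
by rewrite (leq_trans le) // leq_addl.
Qed.

Hypothesis e_gt0 : forall s, s \in Sg -> (0 < e s)%N.
Hypothesis e_le : forall s, s \in Sg -> (e s <= r)%N.
Hypothesis le_rn : (r <= n)%N.
Hypothesis e_uniq : forall t B, (t < r)%N -> #|B| = (n - t)%N ->
  (forall s, s \in Sg -> (e s <= t)%N -> ~~ (s \subset B)) ->
  exists s0, [/\ s0 \in Sg, s0 \subset B, e s0 = t.+1 &
    forall s, s \in Sg -> s \subset B -> e s = t.+1 -> s = s0].

(** Exponents of the ideal (x_i : i outside B) + (M : x^u), M being the ideal of [in_gens]. The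
    quotient has as basis the m supported in B with x^(u + m) outside M, so it stands for a piece of
    S/M translated by x^u. *)
Let piece u B m := (exists2 i, i \notin B & (0 < m i)%N) \/ in_gens (m + u)%MM.

Let piece_up u B : up_closed (piece u B).
Proof.
move=> m m' [[i iB mi]|H]; [left|right]; last by rewrite -addmA; apply: in_gens_up.
by exists i => //; rewrite mnmDE ltn_addl.
Qed.

Variable gs : seq S.
Hypothesis gs_wreg : forall F, #|F| = (n - r)%N -> wreg (famI (fun i => 'X_i) F) gs.

(** The last hypothesis says that no generator with e s at most t divides x^(u + m) for m supported
    in B. At t = r no generator is left and the piece is k[x_B]. For t < r, the piece is cut along
    the variables of the unique generator in B with e s = t + 1. *)
Lemma piece_wreg t u B : (t <= r)%N -> #|B| = (n - t)%N ->
  (forall i, (u i <= t)%N) ->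
  (forall s, s \in Sg -> (e s <= t)%N -> exists i, [/\ i \in s, i \notin B & (u i < e s)%N]) ->
  wreg (monI (piece u B)) gs.
Proof.
move: {2}(r - t)%N (erefl (r - t)%N) => c; elim: c t u B => [|c IHc] t u B rt let_r cB ut inv.
  have tr : t = r by apply/eqP; rewrite eqn_leq let_r -subn_eq0 rt.
  rewrite tr in cB; apply: eq_wreg (gs_wreg cB) => p; rewrite -monI_vars.
  apply: eq_monI => m; split; first by left.
  case=> // -[s sS H].
  have [|i [si iB lt]] := inv s sS; first by rewrite tr e_le.
  by exists i => //; have := H i si; rewrite mnmDE; lia.
have lttr : (t < r)%N by lia.
have [|s0 [s0S s0B s0e s0u]] := e_uniq lttr cB.
  by move=> s sS es; apply/negP => /subsetP sB; have [i [/sB ->]] := inv s sS es.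
(* The bound is relaxed to t + 1 on B, where u is going to be raised. *)
have {}ut : forall i, (u i <= t + (i \in B))%N by move=> i; rewrite (leq_trans (ut i)) ?leq_addr.
(* The inner induction is on the total amount by which u may still be raised on B. If it is 0, u is
   at least t + 1 on s0, so x^u lies in M and the piece vanishes. *)
move: {2}(\sum_(i in B) (t.+1 - u i))%N (leqnn (\sum_(i in B) (t.+1 - u i))%N) => w.
elim: w u ut inv => [|w IHw] u ut inv le.
  apply: wreg1; first exact: monI_ideal.
  move=> m; rewrite msupp1 inE => /eqP->; right; exists s0 => // i si; rewrite add0m.
  have iB := subsetP s0B i si.
  move: le; rewrite leqn0 (bigD1 i) //= addn_eq0 => /andP[+ _]; rewrite subn_eq0.
  by apply: leq_trans; rewrite s0e.
have [/forallP all_ge|] := boolP [forall i in s0, (t < u i)%N].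
  apply: wreg1; first exact: monI_ideal.
  move=> m; rewrite msupp1 inE => /eqP->; right; exists s0 => // i si; rewrite add0m.
  by rewrite s0e; apply: (implyP (all_ge i)).
rewrite negb_forall => /existsP[i]; rewrite negb_imply -leqNgt => /andP[is0 ui].
have iB := subsetP s0B i is0.
(* The colon by x_i raises u at i and keeps t and B; adding x_i removes i from B and passes to t +
   1. *)
apply: (@wreg_filter _ _ 'X_i); first exact: monI_ideal.
  pose u' := (u + U_(i))%MM.
  have u'E j : u' j = (u j + (i == j))%N by rewrite mnmDE mnm1E.
  apply: (eq_wreg _ (IHw u' _ _ _)).
  - move=> p; rewrite colon_monI; apply: eq_monI => m.
    rewrite /piece /u' [(U_(i) + m)%MM]addmC -addmA [(U_(i) + u)%MM]addmC.
    split=> -[[j jB mj]|]; [left|by right|left|by right]; exists j => //.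
      by rewrite mnmDE; lia.
    move: mj; rewrite mnmDE mnm1E; case: eqP => [ij|_]; last by rewrite addn0.
    by rewrite -ij iB in jB.
  - move=> j; rewrite u'E; have := ut j; case: eqP => [<-|_]; last by lia.
    by rewrite iB; lia.
  - move=> s sS es; have [j [js jB lt]] := inv s sS es; exists j; split=> //.
    rewrite u'E; case: eqP => [ij|_]; last by rewrite addn0.
    by rewrite -ij iB in jB.
  - move: le; rewrite (bigD1 i) //= [X in _ -> (X <= _)%N](bigD1 i) //=.
    rewrite u'E eqxx addn1.
    have -> : (\sum_(j in B | j != i) (t.+1 - u' j))%N = (\sum_(j in B | j != i) (t.+1 - u j))%N.
      by apply: eq_bigr => j /andP[_ nji]; rewrite u'E eq_sym (negPf nji) addn0.
    by move: (\sum_(j in B | j != i) _)%N => X; lia.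
apply: (eq_wreg _ (IHc t.+1 u (B :\ i) _ _ _ _ _)) => //.
- move=> p; rewrite add_monI //; apply: eq_monI => m; rewrite /piece.
  split.
    case=> [[j jB mj]|inM]; last by left; right.
    move: jB; rewrite !inE negb_and negbK => /orP[/eqP ji|jB].
      by right; rewrite -ji.
    by left; left; exists j.
  case=> [[[j jB mj]|inM]|mi]; last 1 first.
  - by left; exists i => //; rewrite !inE eqxx.
  - by left; exists j => //; rewrite !inE negb_and jB orbT.
  - by right.
- by lia.
- by have := cardsD1 i B; rewrite iB cB; lia.
- by move=> j; have := ut j; case: (j \in B); lia.
(* For e s = t + 1, either s = s0 and the removed vertex i is the witness, or s has a vertex outside
   B, where u is still at most t. *)
- move=> s sS; rewrite leq_eqVlt => /predU1P[es|]; last first.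
    rewrite ltnS => es; have [j [js jB lt]] := inv s sS es; exists j; split=> //.
    by rewrite !inE negb_and jB orbT.
  have [sB|/subsetPn[j js jB]] := boolP (s \subset B).
    rewrite (s0u s) // s0e; exists i; rewrite !inE eqxx; split=> //.
  exists j; rewrite !inE negb_and jB orbT es; split=> //.
  by have := ut j; rewrite (negPf jB); lia.
Qed.

Lemma gens_wreg : wreg (monI in_gens) gs.
Proof.
apply: (eq_wreg _ (@piece_wreg 0 0%MM setT _ _ _ _)) => //.
- move=> p; apply: eq_monI => m; rewrite /piece addm0; split; last by right.
  by case=> // -[i]; rewrite inE.
- by rewrite cardsT card_ord subn0.
- by move=> i; rewrite mnm0E.
- by move=> s /e_gt0; case: (e s).
Qed.

End MonomialFiltration.

(** * Shifted complexes *)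

Section ShiftedComplexes.
Local Open Scope nat_scope.
Variable n : nat.
Implicit Types (s t B F : {set 'I_n}) (i j v w : 'I_n).

(* The least element of [s], counted from 0; the empty set gets [n]. *)
Definition smin s : nat := #|[set i : 'I_n | [forall j in s, i < j]]|.

(* One plus the number of vertices above [smin s] that are not in [s]; on
   [Sigma_j] this is [n - d - j + 1]. *)
Definition gap s : nat := (n - smin s - #|s|).+1.

Lemma card_ord_lt m : m <= n -> #|[set i : 'I_n | i < m]| = m.
Proof.
move=> lemn; rewrite cardsE -sum1_card (big_ord_narrow lemn).
by rewrite sum1_card card_ord.
Qed.

Lemma smin_ex s : s != set0 ->
  exists v, [/\ v \in s, smin s = v & forall j, j \in s -> v <= j].
Proof.
case/set0Pn=> i0 si0; case: (arg_minnP (fun i : 'I_n => i : nat) si0) => v sv vmin.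
exists v; split=> //; rewrite -[RHS](card_ord_lt (ltnW (ltn_ord v))).
apply: eq_card => i; rewrite !inE; apply/forall_inP/idP => [/(_ v sv)//|ltiv j sj].
by apply: leq_trans ltiv _; apply: vmin.
Qed.

Lemma smin_le s i : i \in s -> smin s <= i.
Proof.
move=> si; have [|v [_ -> ->//]] := @smin_ex s.
by apply/set0Pn; exists i.
Qed.

Lemma card_split s v m : (forall i, i \in s -> i < v -> m <= i) -> m <= v ->
  #|s| <= (v - m) + #|[set i in s | v <= i]|.
Proof.
move=> sm lemv; pose lo x := [set i : 'I_n | i < x].
have /subset_leq_card : s \subset (lo v :\: lo m) :|: [set i in s | v <= i].
  apply/subsetP => i si; rewrite !inE si /=; case: (leqP v i) => [_|ltiv]; first by rewrite orbT.
  by rewrite andbT orbF -leqNgt sm.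
move=> le; apply: (leq_trans le); apply: (leq_trans (leq_card_setU _ _).1).
rewrite leq_add2r cardsD (setIidPr _); last first.
  by apply/subsetP => i; rewrite !inE => /leq_trans; apply.
by rewrite !card_ord_lt // ?(leq_trans lemv) // ltnW.
Qed.

Variable G : {set {set 'I_n}}.
Hypotheses (cG : is_complex G) (shG : shifted G).

Local Notation MN := (min_nonfaces G).

Lemma face_sub s t : s \in G -> t \subset s -> t \in G.
Proof. by case: cG => _ + _; apply. Qed.

Lemma face0 : set0 \in G.
Proof. by case: cG => /set0Pn[s sG] _ _; apply: face_sub sG (sub0set s). Qed.

Lemma min_nonface_ex s : s \notin G -> exists2 t, t \in MN & t \subset s.
Proof.
move=> sG; have [t tmin ts] := @minset_exists _ [pred t | t \notin G] s sG.
have [/= tG tm] := minsetP tmin.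
exists t => //; rewrite inE tG /=; apply/forall_inP => i it; apply/negPn/negP => niG.
by have /setP/(_ i) := tm _ niG (subD1set _ _); rewrite !inE it eqxx.
Qed.

Lemma min_nonfaceN s : s \in MN -> s \notin G.
Proof. by rewrite inE => /andP[]. Qed.

Lemma min_nonface_antichain s t : s \in MN -> t \in MN -> s \subset t -> s = t.
Proof.
move=> sM tM sst; apply/eqP; rewrite eqEsubset sst; apply/subsetP => i it.
apply/negPn/negP => is'; move: tM; rewrite inE => /andP[_ /forall_inP/(_ i it) tiG].
case/negP: (min_nonfaceN sM); apply: face_sub tiG _.
by rewrite subsetD1 sst.
Qed.

Lemma min_nonface_neq0 s : s \in MN -> s != set0.
Proof. by move=> /min_nonfaceN; apply: contraNneq => ->; apply: face0. Qed.

Lemma smin_card_le s : s \in MN -> smin s + #|s| <= n.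
Proof.
move=> /min_nonface_neq0/smin_ex[v [sv -> vmin]].
have := @card_split s v v; rewrite subnn add0n.
pose lo x := [set i : 'I_n | i < x].
have dis : [disjoint lo v & s].
  by rewrite -setI_eq0; apply/eqP/setP => i; rewrite !inE; case: ltnP => //= lt;
     apply/negP => /vmin; rewrite leqNgt lt.
move=> _; rewrite -[X in X + _](card_ord_lt (ltnW (ltn_ord v))) -cardsUI.
by move: dis; rewrite -setI_eq0 => /eqP ->; rewrite cards0 addn0 -[leqRHS]card_ord max_card.
Qed.

(** If the new set were a face, shifting w back down to v would make s a face. *)
Lemma shift_nonface s v w : s \notin G -> v \in s -> w \notin s -> v < w ->
  (w |: s) :\ v \notin G.
Proof.
move=> sG sv sw ltvw; apply: contra sG => tG.
have wt : w \in (w |: s) :\ v by rewrite !inE eqxx andbT; case: eqP ltvw => // ->; rewrite ltnn.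
have := shG tG wt (ltvw : label v < label w); congr (_ \in G); apply/setP => i.
rewrite !inE; have [->|nv] := eqVneq i v; first by rewrite orbT sv.
by rewrite orbF; have [->|] := eqVneq i w; rewrite ?(negPf sw).
Qed.

(** Choose t with the largest least vertex. If some w in B above it were missing from t, exchanging
    the least vertex for w would give a non-face in B, and a minimal non-face in it would have a
    larger least vertex. *)
Lemma top_nonface B : B \notin G -> exists t,
  [/\ t \in MN, t \subset B, forall i, i \in B -> smin t <= i -> i \in t
    & forall s, s \in MN -> s \subset B -> smin s <= smin t].
Proof.
move=> /min_nonface_ex[s0 s0M s0B].
have P0 : (s0 \in MN) && (s0 \subset B) by rewrite s0M.
case: (@arg_maxnP _ s0 (fun s => (s \in MN) && (s \subset B)) smin P0).
move=> t /andP[tM tB] tmax; exists t; split=> //; last first.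
  by move=> s sM sB; apply: tmax; rewrite sM.
move=> w wB le; apply/negPn/negP => tw.
have [v [tv vE vmin]] := smin_ex (min_nonface_neq0 tM).
have ltvw : v < w.
  by rewrite ltn_neqAle -vE le andbT vE; apply: contraNneq tw => /val_inj <-.
have [s sM ss] := min_nonface_ex (shift_nonface (min_nonfaceN tM) tv tw ltvw).
have sB : s \subset B.
  apply: subset_trans ss _; apply/subsetP => i; rewrite !inE => /andP[_ /orP[/eqP->//|]].
  exact: (subsetP tB).
have : smin s <= smin t by apply: tmax; rewrite sM.
rewrite leqNgt vE => /negP[].
have [u [su -> _]] := smin_ex (min_nonface_neq0 sM).
have := subsetP ss u su; rewrite !inE => /andP[nuv /orP[/eqP->//|tu]].
by rewrite ltn_neqAle eq_sym nuv vmin.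
Qed.

(** The part U of B from [smin s] on consists of t and at most smin t - smin s vertices below it, so
    it is no larger than s. Hence s = U contains t, and minimal non-faces form an antichain. *)
Lemma top_nonface_uniq B t s : t \in MN ->
  (forall i, i \in B -> smin t <= i -> i \in t) -> s \in MN -> s \subset B ->
  smin s <= smin t -> smin t + #|t| <= smin s + #|s| -> t \subset B -> s = t.
Proof.
move=> tM tB sM sB lest le ttB.
pose U := [set i in B | smin s <= i].
have sU : s \subset U by apply/subsetP => i si; rewrite inE (subsetP sB) ?smin_le.
have [v [tv vE vmin]] := smin_ex (min_nonface_neq0 tM).
have cU : #|U| <= #|s|.
  have := @card_split U v (smin s); rewrite -vE => /(_ _ lest).
  have -> : [set i in U | smin t <= i] = t.
    apply/setP => i; rewrite !inE; apply/andP/idP => [[/andP[iB _] ?]|it]; first exact: tB.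
    by rewrite (subsetP ttB) // (leq_trans lest) ?smin_le //.
  move=> H; have {}H := H _; apply: leq_trans (H _) _; first by move=> i; rewrite inE => /andP[].
  by lia.
apply/esym/min_nonface_antichain => //.
have /eqP -> : s == U by rewrite eqEcard sU.
by apply/subsetP => i it; rewrite inE (subsetP ttB) // (leq_trans lest) ?smin_le //.
Qed.

(** Let u be the top minimal non-face in the union. If its gap were not smaller, uniqueness would
    force both s and t to equal u. *)
Lemma gap_generic s t : s \in MN -> t \in MN -> s != t -> gap s = gap t ->
  exists u, [/\ u \in MN, u \subset s :|: t & gap u < gap s].
Proof.
move=> sM tM nst est; pose B := s :|: t.
have BG : B \notin G.
  by apply: contra (min_nonfaceN sM) => BG; apply: face_sub BG (subsetUl _ _).
have [u [uM uB top umax]] := top_nonface BG.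
have [lt|ge] := ltnP (gap u) (gap s); first by exists u.
have key r : r \in MN -> r \subset B -> gap r = gap s -> r = u.
  move=> rM rB rs; apply: (top_nonface_uniq uM top) => //; first exact: umax.
  by move: ge; rewrite -rs /gap; have := smin_card_le rM; have := smin_card_le uM; lia.
case/eqP: nst; rewrite (key s sM (subsetUl _ _) erefl).
by rewrite (key t tM (subsetUr _ _)).
Qed.

Variable d : nat.
Hypotheses (dG : complex_dim G = (d%:Z - 1)%R) (puG : pure_of_dim G (complex_dim G)).

Lemma facet_ex s : s \in G -> exists F, [/\ F \in G, s \subset F & #|F| = d].
Proof.
move=> sG; have [F Fmax sF] := @maxset_exists _ (mem G) s sG.
have FG : F \in G := maxsetp Fmax.
exists F; split=> //; have : F \in facets G by rewrite inE.
by move/puG; rewrite dG /face_dim => /(addIr (- 1)%R)[].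
Qed.

Lemma face_card s : s \in G -> #|s| <= d.
Proof. by move/facet_ex => [F [_ /subset_leq_card + <-]]. Qed.

Lemma dim_le : d <= n.
Proof.
have [F [_ _ <-]] := facet_ex face0.
by rewrite -[leqRHS]card_ord max_card.
Qed.

(** Let v be the least vertex of s and F a facet containing s without v. F has no vertex above v
    outside s, by shiftedness, and does not contain v. So F consists of vertices below v and of s
    without v, and d is at most smin s + |s| - 1. *)
Lemma smin_card_gt s : s \in MN -> d < smin s + #|s|.
Proof.
move=> sM; have [v [sv -> vmin]] := smin_ex (min_nonface_neq0 sM).
have sG := min_nonfaceN sM.
have svG : s :\ v \in G by move: sM; rewrite inE => /andP[_ /forall_inP/(_ v sv)].
have [F [FG sF <-]] := facet_ex svG.
have sub : F \subset [set i : 'I_n | i < v] :|: (s :\ v).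
  apply/subsetP => w wF; rewrite !inE; case: (ltngtP w v) => //= [ltvw|wv].
    have [_|sw] := boolP (w \in s); first by
      rewrite andbT; apply: contraTneq ltvw => ->; rewrite ltnn.
    case/negP: (shift_nonface sG sv sw ltvw); apply: face_sub FG _.
    apply/subsetP => i; rewrite !inE => /andP[niv /orP[/eqP->//|si]].
    by apply: (subsetP sF); rewrite !inE niv.
  case/negP: sG; apply: face_sub FG _; apply/subsetP => i si.
  have [->|niv] := eqVneq i v; first by rewrite -(val_inj wv).
  by apply: (subsetP sF); rewrite !inE niv.
have := leq_trans (subset_leq_card sub) (leq_card_setU _ _).1.
rewrite card_ord_lt ?(ltnW (ltn_ord v)) // => le; apply: leq_ltn_trans le _.
by rewrite ltn_add2l [X in _ < X](cardsD1 v) sv.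
Qed.

Lemma gap_le s : s \in MN -> gap s <= n - d.
Proof. by move=> sM; rewrite /gap; have := smin_card_gt sM; have := smin_card_le sM; lia. Qed.

(** As B has more than d vertices, it is a non-face. Its top minimal non-face is a final segment of
    B, so |B| = n - t bounds its gap by t + 1, while the hypothesis makes the gap exceed t. *)
Lemma gap_uniq (t : nat) B : t < n - d -> #|B| = n - t ->
  (forall s, s \in MN -> gap s <= t -> ~~ (s \subset B)) ->
  exists s0, [/\ s0 \in MN, s0 \subset B, gap s0 = t.+1 &
    forall s, s \in MN -> s \subset B -> gap s = t.+1 -> s = s0].
Proof.
move=> ltt cB Bgap.
have BG : B \notin G by apply/negP => /face_card; rewrite cB; lia.
have [s0 [s0M s0B top smax]] := top_nonface BG.
have [v [s0v vE vmin]] := smin_ex (min_nonface_neq0 s0M).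
have gt : t < gap s0 by rewrite ltnNge; apply/negP => /(Bgap _ s0M); rewrite s0B.
have leB : #|B| <= smin s0 + #|s0|.
  have := @card_split B v 0 (fun i _ _ => leq0n i) (leq0n v).
  rewrite subn0 vE => /leq_trans; apply; rewrite leq_add2l subset_leq_card //.
  by apply/subsetP => i; rewrite inE -vE => /andP[]; apply: top.
have gE : gap s0 = t.+1.
  by move: gt leB; rewrite cB /gap; have := smin_card_le s0M; lia.
exists s0; split=> // s sM sB sE; apply: (top_nonface_uniq s0M top) => //.
  exact: smax.
by move: gE sE; rewrite /gap; have := smin_card_le s0M; have := smin_card_le sM; lia.
Qed.

(** All of A lies above v, so v is the least vertex of s. The shift between labels and ordinals
    cancels against |s| = |A| + 1. *)
Lemma Sigma_jP (j : nat) s : Sigma_j d G j s <-> s \in MN /\ d + j = smin s + #|s|.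
Proof.
split.
  case=> sM [A [v [vE Av sE]]]; split=> //.
  have Agt i : i \in A -> v < i.
    by move/(subsetP Av); rewrite !inE -ltnNge.
  have sv : v \in s by rewrite sE !inE eqxx orbT.
  have [w [sw wE wmin]] := smin_ex (min_nonface_neq0 sM).
  have wv : w = v.
    apply/eqP; move: sw; rewrite sE !inE => /orP[/Agt|//].
    by rewrite ltnNge wmin.
  have vA : v \notin A by apply/negP => /Agt; rewrite ltnn.
  have cs : #|s| = #|A|.+1 by rewrite sE setUC cardsU1 vA.
  rewrite wE wv cs.
  have {}vE : (v.+1%:Z = d%:Z - #|A|%:Z + j%:Z)%R by exact: vE.
  by lia.
case=> sM E; split=> //.
have [v [sv vE vmin]] := smin_ex (min_nonface_neq0 sM).
exists (s :\ v), v; split.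
- have cs : #|s| = #|s :\ v|.+1 by rewrite (cardsD1 v) sv.
  by move: E; rewrite vE cs /label; lia.
- apply/subsetP => i; rewrite !inE -ltnNge /label ltnS => /andP[niv /vmin le].
  by rewrite ltn_neqAle le andbT; apply: contraNneq niv => /val_inj ->.
- by rewrite setUC setD1K.
Qed.

Lemma Sigma_j_bounds (j : nat) s : Sigma_j d G j s ->
  [/\ 0 < j, j <= n - d & n - d - j + 1 = gap s].
Proof.
case/Sigma_jP => sM E; have := smin_card_gt sM; have := smin_card_le sM.
by rewrite /gap; split; lia.
Qed.

Lemma min_nonface_Sigma_j s : s \in MN -> exists j : nat, Sigma_j d G j s.
Proof.
move=> sM; exists (smin s + #|s| - d); apply/Sigma_jP; split=> //.
by rewrite subnKC // ltnW // smin_card_gt.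
Qed.

End ShiftedComplexes.

(** * The ideal M *)

(** Classical logic provides the boolean membership that ring quotients require. *)
Lemma idealr_of_ideal (R : comNzRingType) (I : R -> Prop) :
  is_ideal I -> ~ I 1 -> exists J : idealr R, forall x, (x \in (J : pred R)) <-> I x.
Proof.
move=> idI I1; pose b x := boolp.asbool (I x).
have bP x : (x \in b) <-> I x.
  by rewrite -topredE /= /b; split=> /boolp.asboolP.
have bI : idealr_closed b.
  split; [by apply/bP; apply: ideal0|by apply/negP => /bP|].
  by move=> a x y /bP Ix /bP Iy; apply/bP; apply: idealD => //; apply: idealM.
pose J : idealr R := HB.pack b (isIdealr.Build R b bI).
by exists J.
Qed.

Lemma residue_field (R : comNzRingType) (P : R -> Prop) : is_maximal P ->
  exists (K : fieldType) (f : {rmorphism R -> K}),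
    (forall z, exists x, z = f x) /\ (forall x, f x = 0 <-> P x).
Proof.
case=> idP P1 Pmax; have [J JP] := idealr_of_ideal idP P1.
pose Q := {ideal_quot J}.
have pi0 x : \pi_Q x = 0 <-> P x.
  rewrite -JP -[x in x \in _]subr0 Quotient.idealrBE -(rmorph0 (\pi_Q)).
  by split=> [->|/eqP].
have piS (z : Q) : exists x, z = \pi_Q x by exists (repr z); rewrite reprK.
have inv (z : Q) : exists w, z != 0 -> w * z = 1.
  have [x ->] := piS z; have [Px|nPx] := boolp.pselect (P x).
    by exists 0; rewrite (proj2 (pi0 x) Px) eqxx.
  have [|||] := Pmax (addI P x).
  - exact: addI_ideal.
  - by move=> y; apply: addI_sub.
  - case=> a /pi0; rewrite rmorphB rmorphM rmorph1 => /eqP; rewrite subr_eq0 => /eqP E.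
    by exists (\pi_Q a); rewrite mulrC -E.
  - move=> sub; case: nPx; apply: sub; rewrite -[X in addI _ _ X]mulr1.
    exact: addI_gen.
have /boolp.choice[iv ivP] := inv.
(* The choice function is unconstrained at 0, whereas a field structure asks for the inverse of 0 to
   be 0. *)
pose iv' (z : Q) := if z == 0 then 0 else iv z.
have mV (z : Q) : z != 0 -> iv' z * z = 1.
  by move=> nz; rewrite /iv' (negPf nz); apply: ivP.
have iv0 : iv' 0 = 0 by rewrite /iv' eqxx.
pose K : fieldType := HB.pack Q (GRing.ComNzRing_isField.Build Q mV iv0).
pose f : {rmorphism R -> K} := \pi_Q : {rmorphism R -> Q}.
by exists K, f; split.
Qed.

Lemma wreg_surj (A B : comNzRingType) (f : {rmorphism A -> B}) (J : B -> Prop) gs :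
  (forall z, exists x, z = f x) ->
  wreg (fun x => J (f x)) gs -> wreg J (map f gs).
Proof.
move=> surj; elim: gs J => //= g gs IHs J [nz wr]; split.
  by move=> z; have [x ->] := surj z; rewrite -rmorphM; apply: nz.
apply: IHs; apply: eq_wreg wr => x; split=> [[a]|[b]].
  by rewrite rmorphB rmorphM => Ja; exists (f a).
by have [a ->] := surj b; rewrite -rmorphM -rmorphB => Ja; exists a.
Qed.

Lemma preim_ideal (A B : comNzRingType) (f : {rmorphism A -> B}) (I : B -> Prop) :
  is_ideal I -> is_ideal (fun x => I (f x)).
Proof.
move=> idI; split=> [|x y Ix Iy|a x Ix].
- by rewrite rmorph0; apply: ideal0.
- by rewrite rmorphD; apply: idealD.
- by rewrite rmorphM; apply: idealM.
Qed.

Lemma preim_prime (A B : comNzRingType) (f : {rmorphism A -> B}) (P : B -> Prop) :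
  is_prime P -> is_prime (fun x => P (f x)).
Proof.
case=> idP P1 PM; split; first exact: preim_ideal.
- by rewrite rmorph1.
- by move=> x y; rewrite rmorphM; apply: PM.
Qed.

(** * Cohen-Macaulay quotients of polynomial rings, and the three properties of M *)

Section PolynomialQuotient.
Variables (k : fieldType) (n : nat).
Local Notation S := {mpoly k[n]}.
Implicit Types (I J : S -> Prop) (p : S).

Lemma mpoly_generated (A : comNzRingType) (f : {rmorphism S -> A})
    (R : comNzRingType) (phi : {rmorphism R -> A}) s :
  (forall z, exists p, z = f p) -> (forall c, exists r, f c%:MP = phi r) ->
  (forall i, f 'X_i \in s) -> forall z, generated s phi z.
Proof.
move=> surj fC fX z; have [p ->] := surj z; rewrite [p]mpolyE rmorph_sum.
apply: (big_ind (generated s phi)).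
- by rewrite -(rmorph0 phi); apply: generated_base.
- by move=> x y; apply: generatedD.
move=> m _; rewrite -mul_mpolyC rmorphM; apply: generatedM.
  by have [r ->] := fC p@_m; apply: generated_base.
rewrite mpolyXE_id rmorph_prod; apply: (big_ind (generated s phi)).
- by rewrite -(rmorph1 phi); apply: generated_base.
- by move=> x y; apply: generatedM.
move=> i _; rewrite rmorphXn; elim: (m i) => [|e IHe].
  by rewrite expr0 -(rmorph1 phi); apply: generated_base.
by rewrite exprS; apply: generatedM => //; apply: generated_mem.
Qed.

Lemma mpoly_noetherian (A : comNzRingType) (f : {rmorphism S -> A}) :
  (forall z, exists p, z = f p) -> noetherian A.
Proof.
move=> surj; pose phi : {rmorphism k -> A} := f \o @mpolyC n k.
apply: (@noetherian_generated _ _ phi [seq f 'X_i | i <- enum 'I_n]).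
  apply: (mpoly_generated surj) => [c|i]; first by exists c.
  by apply/mapP; exists i => //; rewrite mem_enum.
exact: noetherian_field.
Qed.

Lemma mpoly_zariski (K : fieldType) (f : {rmorphism S -> K}) i :
  (forall z, exists p, z = f p) ->
  exists2 q : {poly k}, q \is monic & f (uni i q) = 0.
Proof.
move=> surj; pose phi : {rmorphism k -> K} := f \o @mpolyC n k.
have [|q monq q0] := @zariski K k phi (f 'X_i) [seq f 'X_j | j <- enum 'I_n].
  apply: (mpoly_generated surj) => [c|j].
    by exists c%:P; rewrite adjoinC.
  by apply/mapP; exists j => //; rewrite mem_enum.
by exists q => //; rewrite /uni -horner_map -map_poly_comp.
Qed.

(** The condition on primes bounds chains through [chain_length] after pulling them back to S; the
    condition on sequences transfers weak regularity from the rings k[x_F] to S/I. *)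
Lemma cohen_macaulay_mpoly d I :
  is_ideal I -> ~ I 1 ->
  (forall Q, is_prime Q -> (forall p, I p -> Q p) ->
     exists2 F : {set 'I_n}, (#|F| <= d)%N & forall i, i \notin F -> Q 'X_i) ->
  (forall gs, (forall F : {set 'I_n}, #|F| = d -> wreg (famI (fun i => 'X_i) F) gs) ->
     wreg I gs) ->
  cohen_macaulay I.
Proof.
move=> idI I1 Iprime Iwreg; have [J JI] := idealr_of_ideal idI I1.
exists J; split=> //; pose R := {ideal_quot J}.
pose f : {rmorphism S -> R} := \pi_R : {rmorphism S -> R}.
have f0 p : f p = 0 <-> I p.
  rewrite -JI -[p in p \in _]subr0 Quotient.idealrBE -(rmorph0 f).
  by split=> [->|/eqP].
have surj (z : R) : exists p, z = f p.
  by exists (repr z); apply: (esym (reprK z)).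
apply: (@cohen_macaulay_ring_of _ d).
- exact: mpoly_noetherian surj.
- move=> P h [C [prC subC _]].
  have [||F cF CF] := Iprime (fun p => C 0%N (f p)).
  + exact/preim_prime/prC.
  + by move=> p /f0 ->; have [/ideal0] := prC 0%N (leq0n _).
  apply: leq_trans cF; apply: (@chain_length k n (fun i p => C i (f p))) => //.
  split=> i lei; first exact/preim_prime/prC.
  have [sub [x [Cx nCx]]] := subC i lei; split=> [p|]; first exact: sub.
  by have [p xp] := surj x; exists p; rewrite -xp.
- move=> P maxP; have [K [g [gS g0]]] := residue_field maxP.
  pose h : {rmorphism S -> K} := g \o f.
  have hS z : exists p, z = h p.
    by have [x ->] := gS z; have [p ->] := surj x; exists p.
  have /boolp.choice[q qP] : forall i, exists q : {poly k}, q \is monic /\ h (uni i q) = 0.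
    by move=> i; have [q ? ?] := mpoly_zariski i hS; exists q.
  (* The factor q i puts the element into P; the factor X makes it a multiple of x_i, as
     [esum_seq_wreg] requires for the family of variables. *)
  pose Y i := 'X * q i.
  have monY i : Y i \is monic by rewrite monicMl ?monicX //; case: (qP i).
  have YE i : uni i (Y i) = uni i (q i) * 'X_i.
    by rewrite /uni /Y rmorphM hornerM /= map_polyX hornerX mulrC.
  have idP : is_ideal P by case: maxP.
  exists (map f (esum_seq Y d)); split; last by rewrite size_map size_esum_seq.
    apply: (wreg_surj surj); apply: (eq_wreg (J := I)) => [p|]; first by rewrite f0.
    apply: Iwreg => F cF; apply: esum_seq_wreg => // i.
      by exists 'X; rewrite /uni map_polyX hornerX.
    by exists (uni i (q i)).
  move=> _ /mapP[p pY ->].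
  apply: (esum_seq_mem (J := fun p => P (f p)) _ _ pY); first exact: preim_ideal.
  move=> i; rewrite YE; apply/g0; rewrite -[LHS]/(h _) rmorphM.
  by case: (qP i) => _ ->; rewrite mul0r.
Qed.

Implicit Types (m : 'X_{1..n}) (gens : seq 'X_{1..n}).

Lemma monomial_ideal_monI gens p :
  monomial_ideal gens p <-> monI (fun m => exists2 g, g \in gens & (g <= m)%MM) p.
Proof.
have idg : is_ideal (@monomial_ideal k n gens) by apply: ideal_gen_ideal.
have up : up_closed (fun m => exists2 g, g \in gens & (g <= m)%MM).
  by move=> m m' [g gg le]; exists g => //; apply: lepm_trans le (lem_addl _ _).
split.
  apply: ideal_gen_sub; first exact: monI_ideal.
  by move=> _ [g gg ->]; apply/monIX; exists g => //; apply: lepm_refl.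
move=> Hp; apply: ideal_of_msupp => // m /Hp[g gg le].
rewrite -(submK le) mpolyXD; apply: idealM => //.
by apply: sub_ideal_gen; exists g.
Qed.

Lemma min_generatorsP I gens : uniq gens ->
  (forall p, I p <-> monomial_ideal gens p) ->
  (forall g h, g \in gens -> h \in gens -> (g <= h)%MM -> g = h) ->
  min_generators I gens.
Proof.
move=> ug IE anti; split=> // m mg Irem.
have /Irem/monomial_ideal_monI/monIX[g] : I 'X_[m].
  by apply/IE; apply: sub_ideal_gen; exists m.
rewrite mem_rem_uniq // inE => /andP[/eqP ngm gg] le.
exact: ngm (anti _ _ gg mg le).
Qed.

Definition set_mnm (s : {set 'I_n}) (c : nat) : 'X_{1..n} := [multinom (i \in s) * c | i < n]%N.

Lemma set_mnmE (s : {set 'I_n}) c i : set_mnm s c i = ((i \in s) * c)%N.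
Proof. exact: mnmE. Qed.

Lemma set_mnm_le (s : {set 'I_n}) c m :
  (set_mnm s c <= m)%MM <-> forall i, i \in s -> (c <= m i)%N.
Proof.
split=> [/mnm_lepP le i si|le]; first by have := le i; rewrite set_mnmE si mul1n.
by apply/mnm_lepP => i; rewrite set_mnmE; have [/le|] := boolP (i \in s); rewrite ?mul1n.
Qed.

Lemma set_mnm_supp s c : (0 < c)%N -> [set i | (0 < set_mnm s c i)%N] = s.
Proof.
by move=> c0; apply/setP => i; rewrite inE set_mnmE muln_gt0 c0 andbT lt0b.
Qed.

Lemma prod_setX (s : {set 'I_n}) c : \prod_(i in s) 'X_i ^+ c = 'X_[set_mnm s c] :> S.
Proof.
rewrite [RHS]mpolyXE_id big_mkcond; apply: eq_bigr => i _; rewrite set_mnmE.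
by case: (i \in s); rewrite ?mul1n ?mul0n ?expr0.
Qed.

Variables (d : nat) (G : {set {set 'I_n}}).
Hypotheses (cG : is_complex G) (dG : complex_dim G = d%:Z - 1).
Hypotheses (shG : shifted G) (puG : pure_of_dim G (complex_dim G)).

Local Notation MN := (min_nonfaces G).

(** On [Sigma_j] the exponent n - d - j + 1 is the gap, and every minimal non-face belongs to some
    [Sigma_j] with j in the range of the sum. *)
Lemma M_idealE p : M_ideal k d G p <-> monI (in_gens MN (@gap n)) p.
Proof.
have idI : is_ideal (@monI k n (in_gens MN (@gap n))) by apply: monI_ideal; apply: in_gens_up.
have idM : is_ideal (M_ideal k d G).
  have idj j : is_ideal (M_j k d G j) by apply: ideal_gen_ideal.
  split.
  - exists (fun=> 0); split=> [j _|]; [exact: ideal0 | by rewrite big1].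
  - move=> x y [q [qM ->]] [q' [qM' ->]]; exists (fun j => q j + q' j).
    by rewrite big_split; split=> // j le; apply: idealD; auto.
  - move=> a x [q [qM ->]]; exists (fun j => a * q j).
    by rewrite mulr_sumr; split=> // j le; apply: idealM; auto.
split.
  case=> q [qM ->]; rewrite big_nat; apply: ideal_sumr => // j le.
  apply: (ideal_gen_sub idI) (qM j le) => _ [s [sj ->]].
  rewrite prod_setX; apply/monIX; exists s; first by case: sj.
  by apply/set_mnm_le; have [_ _ ->] := Sigma_j_bounds cG shG dG puG sj; apply: lepm_refl.
move=> Hp; apply: ideal_of_msupp => // m /Hp[s sM /set_mnm_le le].
rewrite -(submK le) mpolyXD; apply: idealM => //.
have [j sj] := min_nonface_Sigma_j cG shG dG puG sM.
have [j0 jle jE] := Sigma_j_bounds cG shG dG puG sj.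
exists (fun i => if i == j then 'X_[set_mnm s (gap s)] else 0); split.
  move=> i _; case: eqP => [->|_]; last by apply: ideal0; apply: ideal_gen_ideal.
  by apply: sub_ideal_gen; exists s; rewrite prod_setX jE.
rewrite (bigD1_seq j) ?iota_uniq ?mem_index_iota ?j0 //= eqxx big1 ?addr0 //.
by move=> i /negPf ->.
Qed.

Definition gap_mnm s := set_mnm s (gap s).

Definition gens := [seq gap_mnm s | s <- enum MN].

Lemma M_ideal_gens p : M_ideal k d G p <-> monomial_ideal gens p.
Proof.
rewrite M_idealE monomial_ideal_monI; apply: eq_monI => m; split.
  move=> [s sM le]; exists (gap_mnm s); last exact/set_mnm_le.
  by apply: map_f; rewrite mem_enum.
by case=> _ /mapP[s +  ->] /set_mnm_le le; rewrite mem_enum => sM; exists s.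
Qed.

Lemma M_min_generators : min_generators (M_ideal k d G) gens.
Proof.
have supp s : [set i | (0 < gap_mnm s i)%N] = s by apply: set_mnm_supp.
apply: min_generatorsP; last 2 first.
- exact: M_ideal_gens.
- move=> _ _ /mapP[s + ->] /mapP[t + ->]; rewrite !mem_enum => sM tM /mnm_lepP le.
  congr gap_mnm; apply: (min_nonface_antichain cG) => //.
  apply/subsetP => i; rewrite -{1}[s]supp -[t]supp !inE => /leq_trans; apply.
  exact: le.
- rewrite map_inj_uniq ?enum_uniq // => s t st.
  by rewrite -[s]supp st supp.
Qed.

(** Equal positive degrees in a variable mean equal gaps. The minimal non-face of smaller gap in the
    union then has, at each of its vertices, a smaller exponent than the least common multiple. *)
Lemma M_generic : generic (M_ideal k d G).
Proof.
exists gens; split; first exact: M_min_generators.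
move=> _ _ /mapP[s + ->] /mapP[t + ->]; rewrite !mem_enum => sM tM nst [i [ist i0]].
have si : i \in s by move: i0; rewrite set_mnmE muln_gt0 lt0b => /andP[].
have ti : i \in t by move: i0; rewrite ist set_mnmE muln_gt0 lt0b => /andP[].
have st : gap s = gap t by move: ist; rewrite !set_mnmE si ti !mul1n.
have [|u [uM uB lt]] := gap_generic cG shG sM tM _ st.
  by apply: contraNneq nst => ->.
have ltt : (gap u < gap t)%N by rewrite -st.
have neq r : (gap u < gap r)%N -> gap_mnm u != gap_mnm r.
  move=> ltr; apply: contraTneq ltr => E.
  have ur : u = r by rewrite -[u](@set_mnm_supp _ (gap u)) // -/(gap_mnm u) E set_mnm_supp.
  by rewrite ur ltnn.
exists (gap_mnm u); split; [by apply: map_f; rewrite mem_enum | exact: neq | exact: neq |].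
move=> j; rewrite set_mnmE muln_gt0 lt0b => /andP[uj _].
rewrite uj mul1n mnmE !set_mnmE leq_max.
by have := subsetP uB j uj; rewrite inE => /orP[->|->]; rewrite mul1n ?lt ?ltt ?orbT.
Qed.

Lemma stanley_reisner_gens p :
  stanley_reisner k G p <-> monomial_ideal [seq set_mnm s 1 | s <- enum MN] p.
Proof.
have prodX (s : {set 'I_n}) : \prod_(i in s) 'X_i = 'X_[set_mnm s 1] :> S.
  by rewrite -prod_setX; apply: eq_bigr => i _; rewrite expr1.
split; apply: ideal_gen_sub; try exact: ideal_gen_ideal.
  move=> _ [s [sG ->]]; rewrite prodX; apply/monomial_ideal_monI/monIX.
  have [t tM ts] := min_nonface_ex sG.
  exists (set_mnm t 1); first by apply: map_f; rewrite mem_enum.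
  by apply/set_mnm_le => i /(subsetP ts) si; rewrite set_mnmE si.
move=> _ [_ /mapP[s + ->] ->]; rewrite mem_enum => sM.
by apply: sub_ideal_gen; exists s; rewrite prodX (min_nonfaceN sM).
Qed.

Lemma M_deformation : is_deformation (stanley_reisner k G) (M_ideal k d G).
Proof.
have supp s : [set i | (0 < set_mnm s 1 i)%N] = s by apply: set_mnm_supp.
exists [seq set_mnm s 1 | s <- enum MN]; split.
- apply: min_generatorsP; last 2 first.
  + exact: stanley_reisner_gens.
  + move=> _ _ /mapP[s + ->] /mapP[t + ->]; rewrite !mem_enum => sM tM /mnm_lepP le.
    congr set_mnm; apply: (min_nonface_antichain cG) => //.
    apply/subsetP => i; rewrite -{1}[s]supp -[t]supp !inE => /leq_trans; apply.
    exact: le.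
  + rewrite map_inj_uniq ?enum_uniq // => s t st.
    by rewrite -[s]supp st supp.
- by move=> _ /mapP[s _ ->] i; rewrite set_mnmE muln1 leq_b1.
(* A square-free monomial determines its non-face as its support, so the new exponents become a
   function of the monomial. *)
- exists (fun m => gap_mnm [set i | (0 < m i)%N]); split.
    move=> _ /mapP[s _ ->] i; rewrite supp !set_mnmE muln1 muln_gt0.
    by rewrite andbT.
  move=> p; rewrite M_ideal_gens -map_comp.
  suff -> : gens = map ((fun m : 'X_{1..n} => gap_mnm [set i | (0 < m i)%N])
                         \o (set_mnm^~ 1%N)) (enum MN) by [].
  by apply: eq_map => s /=; rewrite supp.
Qed.

Lemma M_cohen_macaulay : cohen_macaulay (M_ideal k d G).
Proof.
have -> : M_ideal k d G = monI (in_gens MN (@gap n)).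
  by apply/boolp.predeqP => p; apply: M_idealE.
apply: (@cohen_macaulay_mpoly d).
- exact/monI_ideal/in_gens_up.
- move/(_ 0%MM); rewrite msupp1 mem_head => /(_ isT)[s sM le].
  have /set0Pn[i /le] := min_nonface_neq0 cG sM.
  by rewrite mnm0E.
(* F collects the variables outside Q. It is a face: otherwise Q would contain a product of powers
   of variables outside Q. Hence F has at most d vertices. *)
- move=> Q [idQ Q1 QM] MQ; pose F := [set i : 'I_n | ~~ boolp.asbool (Q 'X_i)].
  have QP i : i \notin F -> Q 'X_i by rewrite inE negbK => /boolp.asboolP.
  exists F => //; apply: (face_card dG puG); apply/negPn/negP.
  move=> /min_nonface_ex[s sM sF].
  have : Q 'X_[gap_mnm s].
    by apply: MQ; apply/monIX; exists s => // i si; rewrite set_mnmE si mul1n.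
  rewrite -prod_setX; have {sM} : forall i, i \in s -> ~ Q 'X_i.
    by move=> i /(subsetP sF); rewrite inE => /negP nQ Qi; apply: nQ; apply/boolp.asboolP.
  rewrite -big_enum /= => nQ; have : {subset enum s <= s} by move=> i; rewrite mem_enum.
  elim: (enum s) => [|i r IHr] sub; first by rewrite big_nil.
  rewrite big_cons => /QM[|]; last by apply: IHr => j jr; apply: sub; rewrite inE jr orbT.
  elim: (gap s) => [|e IHe]; first by rewrite expr0.
  by rewrite exprS => /QM[|//]; apply/nQ/sub/mem_head.
- move=> gs gsF; apply: (@gens_wreg _ _ _ _ (n - d)) => //.
  + by move=> s; apply: (gap_le cG).
  + exact: leq_subr.
  + by move=> t B; apply: (gap_uniq cG).
  + by move=> F; rewrite subKn ?(dim_le cG) //; apply: gsF.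
Qed.

End PolynomialQuotient.

Theorem theorem3p7 (k : fieldType) (n d : nat) (Gamma : {set {set 'I_n}})
    (Gamma_complex : is_complex Gamma)
    (Gamma_dim : complex_dim Gamma = d%:Z - 1)
    (Gamma_shifted : shifted Gamma)
    (Gamma_shellable : shellable Gamma) :
  [/\ is_deformation (stanley_reisner k Gamma) (M_ideal k d Gamma),
      generic (M_ideal k d Gamma)
    & cohen_macaulay (M_ideal k d Gamma)].
Proof.
have [Gamma_pure _] := Gamma_shellable; split.
- exact: M_deformation.
- exact: M_generic.
- exact: M_cohen_macaulay.
Qed.
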